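(* Let $\gamma,b,c,d,\mathcal{K},K,\mathcal{V}$, $G_h$ be as in the context. Let $(V_h,E_h)$ be a family in $\mathcal{V}\times K$, indexed by a sequence of values of $h$ tending to $0$, with $V_h(x)=x^\gamma W_h(x)$, such that, as $h\to0$ along the sequence, $W_h|_{[0,d]}\to W_0$ in $C^\infty([0,d])$ and $E_h\to E_0$; set $V_0(x)=x^\gamma W_0(x)$ on $[0,d]$. Let $G_h$ denote the function $G_h(\cdot;E_h)$ associated with the potential $V_h$, and assume that the functionals $\mu_h(a)=\langle\mathrm{Op}_h(a)G_h,G_h\rangle$, $a\in C_c^\infty((0,d)\times\mathbb{R})$, converge along the sequence to a measure $\mu_0$ on $(0,d)\times\mathbb{R}$, i.e. $\mu_h(a)\to\int a\,d\mu_0$ for every such $a$. Then the support of $\mu_0$ is a subset of the energy surface $$\{(x,\xi)\in(0,d)\times\mathbb{R}:\ \xi^2+V_0(x)=E_0\},$$ and $\mu_0$ is invariant by the Hamiltonian flow of $p_0(x,\xi)=\xi^2+V_0(x)$.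
   Context: Fix $\gamma>0$, real numbers $0<b<c<d$, a compact subset $\mathcal{K}$ of $C^\infty([0,d];\mathbb{R})$ (with its Fréchet topology) and a compact set $K\subset(0,+\infty)$. $\mathcal{V}$ denotes the set of potentials $V:[0,+\infty)\to\mathbb{R}$ such that: (i) $V$ is smooth on $(0,+\infty)$, continuous on $[0,+\infty)$, and $V(0)=0$; (ii) there is a smooth function $W$ on $[0,+\infty)$ with $W(0)>0$ and $V(x)=x^\gamma W(x)$ for all $x>0$; (iii) $V(x)\geq V(d)$ for all $x\geq d$ and $V'(x)>0$ for all $x\in(0,d]$; (iv) $W|_{[0,d]}\in\mathcal{K}$; (v) for all $E\in K$, $E-V(x)>0$ for $x\in[0,b]$ and $V(x)-E>0$ for $x\in[c,d]$. For $(V,E)\in\mathcal{V}\times K$ and $h>0$, $G_h(\cdot;E)$ (which also depends on $V$) is the unique real solution on $[0,+\infty)$ of $-h^2G''+(V-E)G=0$ with $\int_0^{+\infty}|G_h(x;E)|^2dx=1$ and $G_h(x;E)>0$ for all $x\geq d$ (the space of $L^2$ solutions is one-dimensional; no boundary condition is imposed at $0$). $\mathrm{Op}_h$ is a standard semiclassical quantization procedure on $\mathbb{R}$ (for instance the Weyl quantization), applied to symbols $a\in C_c^\infty((0,d)\times\mathbb{R})$; $G_h$ is regarded as an element of $L^2(\mathbb{R})$ by extension by $0$ and $\langle\cdot,\cdot\rangle$ is the $L^2$ inner product. By compactness of $\mathcal{K}$ and $K$, sequences with the stated convergences always exist after extraction of subsequences. Since the flow may leave $(0,d)\times\mathbb{R}$,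 invariance of $\mu_0$ under the Hamiltonian flow of $p_0$ means $\int\{p_0,a\}\,d\mu_0=0$ for all $a\in C_c^\infty((0,d)\times\mathbb{R})$, where $\{\cdot,\cdot\}$ is the Poisson bracket. *)

(* Defs.v *)
From HB Require Import structures.
From mathcomp Require Import all_boot all_order all_algebra.
From mathcomp Require Import all_classical all_reals all_analysis.
From mathcomp Require Import complex.

Set Implicit Arguments.
Unset Strict Implicit.
Unset Printing Implicit Defensive.

Import Order.TTheory GRing.Theory Num.Theory.
Import numFieldNormedType.Exports.

Local Open Scope classical_set_scope.
Local Open Scope ring_scope.
Local Open Scope complex_scope.

(* Differentiation relative to a set [A] (in practice an interval): the
   difference quotient at [x] is taken along [y] in [A], [y <> x], so that it is
   one-sided at an end point of [A].  Everything below depends only on the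
   values of [f] on [A]: functions on an interval are represented by total
   functions whose values off the interval are irrelevant. *)
Section WithinDerivatives.
Variable R : realType.
Implicit Types (A : set R) (f : R -> R).

Definition derivable_within A f (x : R) : Prop :=
  cvg ((fun y => (f y - f x) / (y - x)) @ within A x^').

Definition deriv_within A f (x : R) : R :=
  lim ((fun y => (f y - f x) / (y - x)) @ within A x^').

Definition dern_within A (n : nat) f : R -> R := iter n (deriv_within A) f.

Definition smooth_on A f : Prop :=
  forall (n : nat) (x : R), A x -> derivable_within A (dern_within A n f) x.

(* The Frechet topology of C^oo([0,d]) is the coarsest one for which every map
   f |-> f^(n) is continuous for uniform convergence on [0,d].  It is put here on
   all total functions and only used for functions smooth on [0,d]; functions
   that agree on [0,d] are topologically indistinguishable. *)
Definition jet (d : R) (f : R -> R) : {ptws nat -> {uniform` `[0, d] -> R}} :=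
  fun n => dern_within `[0, d] n f.

Definition Cinfty (d : R) := initial_topology (jet d).

End WithinDerivatives.

Section Potentials.
Variable R : realType.

(* V belongs to the class of potentials, W being the smooth factor of V. *)
Definition potential_with (gamma b c d : R) (KK : set (Cinfty d)) (K : set R)
    (V W : R -> R) : Prop :=
  [/\ [/\ smooth_on `]0, +oo[ V, {within `[0, +oo[, continuous V} & V 0 = 0],
      [/\ smooth_on `[0, +oo[ W, 0 < W 0 &
          forall x, 0 < x -> V x = x `^ gamma * W x],
      (forall x, d <= x -> V d <= V x) /\
        (forall x, 0 < x <= d -> 0 < derive1 V x),
      exists2 f : R -> R, KK f & {in `[0, d], W =1 f} &
      forall E, K E ->
        (forall x, 0 <= x <= b -> 0 < E - V x) /\
        (forall x, c <= x <= d -> 0 < V x - E)].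

(* G is a solution on [0, +oo[ of - h^2 G'' + (V - E) G = 0. *)
Definition schrodinger_solution (h : R) (V : R -> R) (E : R) (G : R -> R) :
    Prop :=
  forall x, 0 <= x ->
    [/\ derivable_within `[0, +oo[ G x,
        derivable_within `[0, +oo[ (deriv_within `[0, +oo[ G) x &
        - h ^+ 2 * dern_within `[0, +oo[ 2 G x + (V x - E) * G x = 0].

(* These conditions characterize G_h(.; E) on [0, +oo[. *)
Definition is_Gh (d h : R) (V : R -> R) (E : R) (G : R -> R) : Prop :=
  [/\ schrodinger_solution h V E G,
      (\int[lebesgue_measure]_(x in `[0%R, +oo[) (`|G x| ^+ 2)%:E = 1)%E &
      forall x, d <= x -> 0 < G x].

End Potentials.

Section PhaseSpace.
Variable R : realType.

Definition phase_domain (d : R) : set (R * R) :=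
  [set z | 0 < z.1 < d].

Definition dx (f : R * R -> R) : R * R -> R :=
  fun z => derive1 (fun x => f (x, z.2)) z.1.

Definition dxi (f : R * R -> R) : R * R -> R :=
  fun z => derive1 (fun xi => f (z.1, xi)) z.2.

Fixpoint Ck (k : nat) (f : R * R -> R) : Prop :=
  continuous f /\
  if k is k'.+1 then
    (forall z, derivable (fun x => f (x, z.2)) z.1 1 /\
               derivable (fun xi => f (z.1, xi)) z.2 1) /\
    Ck k' (dx f) /\ Ck k' (dxi f)
  else True.

Definition smooth2 (f : R * R -> R) : Prop := forall k, Ck k f.

Definition Re_fun (T : Type) (f : T -> R[i]) : T -> R := fun z => complex.Re (f z).
Definition Im_fun (T : Type) (f : T -> R[i]) : T -> R := fun z => complex.Im (f z).

(* C_c^oo(]0,d[ x R), each symbol being extended by zero to R x R. *)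
Definition symbol (d : R) (a : R * R -> R[i]) : Prop :=
  [/\ smooth2 (Re_fun a), smooth2 (Im_fun a),
      compact (closure [set z | a z != 0]) &
      closure [set z | a z != 0] `<=` phase_domain d].

Definition poisson (p : R * R -> R) (a : R * R -> R[i]) : R * R -> R[i] :=
  fun z =>
    (dxi p z)%:C * (dx (Re_fun a) z +i* dx (Im_fun a) z)
    - (dx p z)%:C * (dxi (Re_fun a) z +i* dxi (Im_fun a) z).

Definition cintegral (disp : measure_display) (T : measurableType disp)
    (mu : {measure set T -> \bar R}) (D : set T) (f : T -> R[i]) : R[i] :=
  (Rintegral mu D (Re_fun f)) +i* (Rintegral mu D (Im_fun f)).

Definition ccvg (u : nat -> R[i]) (l : R[i]) : Prop :=
  Re_fun u @ \oo --> complex.Re l /\ Im_fun u @ \oo --> complex.Im l.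

End PhaseSpace.

Section Quantization.
Variable R : realType.

Definition expi (theta : R) : R[i] := cos theta +i* sin theta.

(* The t-quantization, t in [0,1]; t = 1/2 is the Weyl quantization and t = 1
   the standard (left) one:
     Op_h(a)u(x) = (2 pi h)^-1 int int e^{i(x-y)xi/h} a(tx+(1-t)y, xi) u(y) dxi dy.
   Integrating in xi first makes the y-integral absolutely convergent for every
   u in L^2, for all t. *)
Definition op_kernel (t h : R) (a : R * R -> R[i]) (x y : R) : R[i] :=
  ((2 * pi * h)^-1)%:C *
  cintegral lebesgue_measure setT
    (fun xi : R => expi ((x - y) * xi / h) * a (t * x + (1 - t) * y, xi)).

Definition Op (t h : R) (a : R * R -> R[i]) (u : R -> R[i]) : R -> R[i] :=
  fun x => cintegral lebesgue_measure setT
             (fun y : R => op_kernel t h a x y * u y).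

Definition L2_inner (u v : R -> R[i]) : R[i] :=
  cintegral lebesgue_measure setT (fun x : R => u x * conjc (v x)).

Definition extend0 (G : R -> R) : R -> R[i] :=
  fun x => ((G \_ `[0, +oo[) x)%:C.

Definition mu_h (t h : R) (G : R -> R) (a : R * R -> R[i]) : R[i] :=
  L2_inner (Op t h a (extend0 G)) (extend0 G).

End Quantization.

Section Measures.
Variable R : realType.

Definition plane := (measurableTypeR R * measurableTypeR R)%type.

(* A (positive, locally finite) measure on ]0,d[ x R is encoded by the Borel
   measure on the plane that gives mass 0 to the complement. *)
Definition measure_on_domain (d : R) (mu : {measure set plane -> \bar R}) :
    Prop :=
  mu (~` phase_domain d) = 0%E /\
  forall C : set (R * R), compact C -> C `<=` phase_domain d -> (mu C < +oo)%E.

Definition msupport (d : R) (mu : {measure set plane -> \bar R}) :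
    set (R * R) :=
  [set z | phase_domain d z /\
           forall U : set (R * R), open U -> U z -> (0 < mu U)%E].

Definition flow_invariant (d : R) (p : R * R -> R)
    (mu : {measure set plane -> \bar R}) : Prop :=
  forall a, symbol d a -> cintegral mu (phase_domain d) (poisson p a) = 0.

End Measures.

(* Main.v *)
Require Import Defs.
From HB Require Import structures.
From mathcomp Require Import all_boot all_order all_algebra.
From mathcomp Require Import all_classical all_reals all_analysis.
From mathcomp Require Import measurable_realfun complex.
From mathcomp Require Import ring lra.
Import Order.TTheory GRing.Theory Num.Theory.
Import numFieldNormedType.Exports.
Set Implicit Arguments.
Unset Strict Implicit.
Unset Printing Implicit Defensive.
Local Open Scope classical_set_scope.
Local Open Scope ring_scope.

(** Both conclusions concern the limits of mu_h(b) for two kinds of symbols b built from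
a symbol a: (p0 - E0) a for the support and {p0, a} for the invariance. Taking real and
imaginary parts, it is enough to treat real symbols and the real part of mu_h(b), and to
show that this real part tends to 0.

For a real symbol a, [Re_mu_h] writes 2 pi h Re mu_h(a) as the double integral of
A(m, s) G(x) G(y), where m = t x + (1 - t) y, s = (x - y) / h, and A(m, s) is the
integral of cos(s xi) a(m, xi) over xi. Under this cosine transform, multiplying a by xi
amounts to differentiating A in s, up to a quarter period of the phase; hence h^2 times the second
derivative in y of the kernel of a is minus the kernel of xi^2 a, up to O(h), and h times the
difference of the second derivatives in x and in y is twice the kernel of xi times the
x-derivative of a, up to O(h). Integrating by parts twice moves these derivatives onto
G, where h^2 G'' = (V - E) G: this produces the kernel times V(y) - E in the first case and
the kernel times (V(x) - V(y)) / h, which is close to s V'(m), in the second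
([energy_estimate], [flow_estimate]). A factor s in front of A is an xi-derivative of a.
So the symbol (xi^2 + V - E) a and the symbol 2 xi d_x a - V' d_xi a give
expressions of size O(h), and the convergence of V_h to V_0 in C^1 on compact subsets of
]0, d[, together with that of E_h to E_0, replaces V and E by their limits.

Two facts control the errors. The form of a kernel bounded by K / (1 + s^2) is at
most K h pi, because G has norm 1 ([quad_le]); and A decays in s faster than any power, so
that a factor x - y = h s is worth a factor h. In particular a cut-off function of
x - y costs only O(h): inserting one confines x and y to a compact subset of ]0, d[,
where V_h is controlled, and removes all boundary terms.

Since {p0, a} is a symbol, invariance follows at once ([flow_limit]). For the support,
let a be a bump function near a point where p0 - E0 does not vanish: (p0 - E0) a has a
constant sign and integral 0 ([energy_limit]), so that the measure has no mass near that
point ([null_of_Rintegral0]). *)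

(** * One-variable calculus *)
Section Calculus.
Context {R : realType}.
Implicit Types (f g : R -> R) (x : R).

Lemma is_derive1_eq f x (c c' : R) : is_derive x 1 f c -> c = c' -> is_derive x 1 f c'.
Proof. by move=> ? <-. Qed.

Lemma is_derive1_val f x (c : R) : is_derive x 1 f c -> derive1 f x = c.
Proof. by move=> ?; rewrite derive1E derive_val. Qed.

Lemma derivable_is_derive1 f x : derivable f x 1 -> is_derive x 1 f (derive1 f x).
Proof. by move=> df; apply: DeriveDef; [exact: df|rewrite derive1E]. Qed.

Lemma is_derive1D f g x (c c' : R) : is_derive x 1 f c -> is_derive x 1 g c' ->
  is_derive x 1 (fun y => f y + g y) (c + c').
Proof. move=> df dg; exact: (is_deriveD df dg). Qed.

Lemma is_derive1N f x (c : R) : is_derive x 1 f c ->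
  is_derive x 1 (fun y => - f y) (- c).
Proof. move=> df; exact: (is_deriveN df). Qed.

Lemma is_derive1M f g x (c c' : R) : is_derive x 1 f c -> is_derive x 1 g c' ->
  is_derive x 1 (fun y => f y * g y) (c * g x + f x * c').
Proof.
move=> df dg; apply: (is_derive1_eq (is_deriveM df dg)).
by rewrite /GRing.scale /= addrC (mulrC c).
Qed.

Lemma is_derive1_affine (p q x : R) : is_derive x 1 (fun y => p + q * y) q.
Proof.
apply: (is_derive1_eq (is_derive1D (is_derive_cst p x 1)
  (is_derive1M (is_derive_cst q x 1) (is_derive_id x 1)))).
by rewrite mul0r !add0r mulr1.
Qed.

Lemma is_derive1_comp_affine f (p q x c : R) : is_derive (p + q * x) 1 f c ->
  is_derive x 1 (fun y => f (p + q * y)) (q * c).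
Proof.
move=> df; have dg := is_derive1_affine p q x.
apply: (is_derive1_eq (@is_derive1_comp _ f (fun y => p + q * y) x _ _ df dg)).
by rewrite mulrC.
Qed.

Lemma is_derive1_continuous f x (c : R) : is_derive x 1 f c -> {for x, continuous f}.
Proof. by case=> df _; apply/differentiable_continuous/derivable1_diffP. Qed.

Lemma mean_value_le f f' (a b K : R) :
  (forall x, Num.min a b <= x <= Num.max a b -> is_derive x 1 f (f' x)) ->
  (forall x, Num.min a b <= x <= Num.max a b -> `|f' x| <= K) ->
  `|f b - f a| <= K * `|b - a|.
Proof.
wlog ab : a b / a <= b.
  move=> H; case: (leP a b) => [ab|/ltW ba] D B.
    by apply: H => // x; rewrite ?(min_l ab) ?(max_r ab); [exact: D|exact: B].
  rewrite distrC (distrC b); apply: H => // x;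
    rewrite (min_l ba) (max_r ba); [exact: D|exact: B].
rewrite (min_l ab) (max_r ab) => D B.
have D' x : x \in `]a, b[ -> is_derive x 1 f (f' x).
  by rewrite in_itv/= => /andP[/ltW ? /ltW ?]; apply: D; apply/andP.
have cf : {within `[a, b], continuous f}.
  apply: continuous_in_subspaceT => x; rewrite inE/= in_itv/= => /D.
  exact: is_derive1_continuous.
have [z] := MVT_segment ab D' cf; rewrite in_itv/= => /B Bz ->.
by rewrite normrM ler_wpM2r.
Qed.

End Calculus.

(** * Smooth functions of one and two variables *)
Section Smooth2.
Context {R : realType}.
Implicit Types (f g a : R * R -> R).

Lemma Ck_cont k f : Ck k f -> continuous f.
Proof. by case: k => [|k] []. Qed.

Lemma Ck_dx k f : Ck k.+1 f -> Ck k (dx f).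
Proof. by case=> _ [_ []]. Qed.

Lemma Ck_dxi k f : Ck k.+1 f -> Ck k (dxi f).
Proof. by case=> _ [_ []]. Qed.

Lemma Ck_is_dx k f (z : R * R) : Ck k.+1 f ->
  is_derive z.1 1 (fun x => f (x, z.2)) (dx f z).
Proof. by case=> _ [/(_ z)[/derivable_is_derive1]]. Qed.

Lemma Ck_is_dxi k f (z : R * R) : Ck k.+1 f ->
  is_derive z.2 1 (fun xi => f (z.1, xi)) (dxi f z).
Proof. by case=> _ [/(_ z)[_ /derivable_is_derive1]]. Qed.

Lemma CkS k f : Ck k.+1 f -> Ck k f.
Proof.
elim: k f => [|k IH] f; first by case.
move=> [cf [df [dxf dxif]]]; split; first exact: cf.
split; first exact: df.
by split; [exact: (IH _ dxf)|exact: (IH _ dxif)].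
Qed.

Lemma Ck_intro k f f1 f2 : continuous f ->
  (forall x xi : R, is_derive x 1 (fun x => f (x, xi)) (f1 (x, xi))) ->
  (forall x xi : R, is_derive xi 1 (fun xi => f (x, xi)) (f2 (x, xi))) ->
  Ck k f1 -> Ck k f2 -> Ck k.+1 f.
Proof.
move=> cf d1 d2 C1 C2; split => //; split.
  by move=> [x xi] /=; split; [case: (d1 x xi)|case: (d2 x xi)].
have -> : dx f = f1 by apply/funext => -[x xi]; apply: is_derive1_val; exact: d1.
by have -> : dxi f = f2 by apply/funext => -[x xi]; apply: is_derive1_val; exact: d2.
Qed.

Lemma Ck_cst k (c : R) : Ck k (fun _ : R * R => c).
Proof.
elim: k c => [|k IH] c; first by split=> // z; exact: cst_continuous.
apply: (Ck_intro (f1 := fun _ : R * R => 0 : R) (f2 := fun _ : R * R => 0 : R)).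
- by move=> z; exact: cst_continuous.
- by move=> x xi; exact: is_derive_cst.
- by move=> x xi; exact: is_derive_cst.
- exact: (IH 0).
- exact: (IH 0).
Qed.

Lemma Ck_snd k : Ck k (fun z : R * R => z.2).
Proof.
have c2 : continuous (fun z : R * R => z.2) by move=> z; exact: cvg_snd.
case: k => [|k]; first by split.
apply: (Ck_intro (f1 := fun _ : R * R => 0 : R) (f2 := fun _ : R * R => 1 : R)).
- exact: c2.
- by move=> x xi; exact: is_derive_cst.
- exact: Ck_cst.
- exact: Ck_cst.
Qed.

Lemma CkD k f g : Ck k f -> Ck k g -> Ck k (fun z => f z + g z).
Proof.
elim: k f g => [|k IH] f g Cf Cg.
  by split=> // z; apply: cvgD; [exact: (Ck_cont Cf)|exact: (Ck_cont Cg)].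
apply: (Ck_intro (f1 := fun z => dx f z + dx g z) (f2 := fun z => dxi f z + dxi g z)).
- by move=> z; apply: cvgD; [exact: (Ck_cont Cf)|exact: (Ck_cont Cg)].
- by move=> x xi; apply: is_derive1D;
    [exact: (Ck_is_dx (x, xi) Cf)|exact: (Ck_is_dx (x, xi) Cg)].
- by move=> x xi; apply: is_derive1D;
    [exact: (Ck_is_dxi (x, xi) Cf)|exact: (Ck_is_dxi (x, xi) Cg)].
- by apply: IH; exact: Ck_dx.
- by apply: IH; exact: Ck_dxi.
Qed.

Lemma CkM k f g : Ck k f -> Ck k g -> Ck k (fun z => f z * g z).
Proof.
elim: k f g => [|k IH] f g Cf Cg.
  by split=> // z; apply: cvgM; [exact: (Ck_cont Cf)|exact: (Ck_cont Cg)].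
apply: (Ck_intro (f1 := fun z => dx f z * g z + f z * dx g z)
                 (f2 := fun z => dxi f z * g z + f z * dxi g z)).
- by move=> z; apply: cvgM; [exact: (Ck_cont Cf)|exact: (Ck_cont Cg)].
- by move=> x xi; apply: is_derive1M;
    [exact: (Ck_is_dx (x, xi) Cf)|exact: (Ck_is_dx (x, xi) Cg)].
- by move=> x xi; apply: is_derive1M;
    [exact: (Ck_is_dxi (x, xi) Cf)|exact: (Ck_is_dxi (x, xi) Cg)].
- apply: CkD.
    exact: (IH _ _ (Ck_dx Cf) (CkS Cg)).
  exact: (IH _ _ (CkS Cf) (Ck_dx Cg)).
- apply: CkD.
    exact: (IH _ _ (Ck_dxi Cf) (CkS Cg)).
  exact: (IH _ _ (CkS Cf) (Ck_dxi Cg)).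
Qed.

End Smooth2.

Section Smooth1.
Context {R : realType}.
Implicit Types (f g : R -> R) (A : set R).

(** Differentiability to order k + 1 on [A], in one variable. Restricting to [A] makes room
for potentials, which may be singular at 0. *)
Fixpoint Dk (k : nat) (A : set R) (f : R -> R) : Prop :=
  (forall x, A x -> derivable f x 1) /\
  if k is k'.+1 then Dk k' A (derive1 f) else True.

Lemma Dk_derivable k A f x : Dk k A f -> A x -> derivable f x 1.
Proof. by case: k => [|k] [+ _]; apply. Qed.

Lemma DkS k A f : Dk k.+1 A f -> Dk k A f.
Proof.
elim: k f => [|k IH] f [df Df]; first by split; [exact: df|].
split; [exact: df|exact: (IH _ Df)].
Qed.

Lemma Dk_is k A f x : Dk k A f -> A x -> is_derive x 1 f (derive1 f x).
Proof. by move=> /Dk_derivable Df /Df /derivable_is_derive1. Qed.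

Lemma Dk_ext k A f g : open A -> {in A, f =1 g} -> Dk k A f -> Dk k A g.
Proof.
move=> oA; elim: k f g => [|k IH] f g fg Df.
  split => // x Ax; apply: near_eq_derivable (Dk_derivable Df Ax).
  by near=> y; apply: fg; rewrite inE; near: y; exact: open_nbhs_nbhs.
split.
  move=> x Ax; apply: near_eq_derivable (Dk_derivable Df Ax).
  by near=> y; apply: fg; rewrite inE; near: y; exact: open_nbhs_nbhs.
apply: IH (proj2 Df) => x; rewrite inE => Ax; rewrite !derive1E; apply: near_eq_derive.
by near=> y; apply: fg; rewrite inE; near: y; exact: open_nbhs_nbhs.
Unshelve. all: by end_near. Qed.

Lemma Dk_intro k A f f1 : open A -> (forall x, A x -> is_derive x 1 f (f1 x)) ->
  Dk k A f1 -> Dk k.+1 A f.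
Proof.
move=> oA df Df; split; first by move=> x /df[].
apply: Dk_ext Df => // x; rewrite inE => /df df1; by rewrite (is_derive1_val df1).
Qed.

Lemma DkD k A f g : open A -> Dk k A f -> Dk k A g -> Dk k A (fun x => f x + g x).
Proof.
move=> oA; elim: k f g => [|k IH] f g Df Dg.
  split => // x Ax.
  by have [] := is_derive1D (Dk_is Df Ax) (Dk_is Dg Ax).
apply: (@Dk_intro k A (fun x => f x + g x)
  (fun x => derive1 f x + derive1 g x)); first exact: oA.
  by move=> x Ax; apply: is_derive1D; [exact: Dk_is Df Ax|exact: Dk_is Dg Ax].
exact: (IH _ _ (proj2 Df) (proj2 Dg)).
Qed.

Lemma DkM k A f g : open A -> Dk k A f -> Dk k A g -> Dk k A (fun x => f x * g x).
Proof.
move=> oA; elim: k f g => [|k IH] f g Df Dg.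
  split => // x Ax.
  by have [] := is_derive1M (Dk_is Df Ax) (Dk_is Dg Ax).
apply: (@Dk_intro k A (fun x => f x * g x)
  (fun x => derive1 f x * g x + f x * derive1 g x)).
    exact: oA.
  by move=> x Ax; apply: is_derive1M; [exact: Dk_is Df Ax|exact: Dk_is Dg Ax].
apply: DkD; first exact: oA.
  exact: (IH _ _ (proj2 Df) (DkS Dg)).
exact: (IH _ _ (DkS Df) (proj2 Dg)).
Qed.

Lemma Dk_cst k A (c : R) : open A -> Dk k A (fun=> c).
Proof.
move=> oA; elim: k c => [|k IH] c; first by split.
have d0 x : A x -> is_derive x 1 (fun _ : R => c) (0 : R).
  by move=> _; exact: is_derive_cst.
exact: (@Dk_intro k A (fun=> c) (fun=> 0) oA d0 (IH 0)).
Qed.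

Lemma Dk_powR k (d r : R) : Dk k `]0, d[ (fun x => x `^ r).
Proof.
elim: k r => [|k IH] r.
  by split=> // x /=; rewrite in_itv/= => /andP[x0 _]; have [] := is_derive1_powR r x0.
apply: (@Dk_intro k `]0, d[ (fun x => x `^ r) (fun x => r * x `^ (r - 1))).
- exact: interval_open.
- by move=> x /=; rewrite in_itv/= => /andP[x0 _]; exact: is_derive1_powR.
- apply: DkM; first exact: interval_open.
    by apply: Dk_cst; exact: interval_open.
  exact: IH.
Qed.

End Smooth1.

(** * Real symbols supported in a box *)
Section BoxSymbols.
Context {R : realType}.
Implicit Types (f g a : R * R -> R) (al be M : R).

(** Real symbols together with a box [al, be] x [-M, M] containing their support; the
estimates depend on the symbol through bounds on this box. *)
Definition boxsym al be M a := smooth2 a /\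
  forall x xi, ~~ ((al <= x <= be) && (- M <= xi <= M)) -> a (x, xi) = 0.

Lemma near_notin_itv (p q x : R) : ~~ (p <= x <= q) ->
  \forall y \near x, ~~ (p <= y <= q).
Proof.
rewrite negb_and -!ltNge => /orP[xp|qx]; near=> y; rewrite negb_and -!ltNge.
- by apply/orP; left; near: y; exact: lt_nbhsl.
- by apply/orP; right; near: y; exact: lt_nbhsr.
Unshelve. all: by end_near. Qed.

Lemma boxsym_dx al be M a : boxsym al be M a -> boxsym al be M (dx a).
Proof.
move=> [sa za]; split; first by move=> k; apply: Ck_dx; exact: sa.
move=> x xi; rewrite negb_and => H; rewrite /dx/=.
rewrite derive1E (near_eq_derive (g := cst 0)) ?derive_cst//.
case/orP: H => H; last by near=> y; rewrite /= za// negb_and H orbT.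
near=> y; rewrite /= za// negb_and; apply/orP; left.
by near: y; exact: near_notin_itv.
Unshelve. all: by end_near. Qed.

Lemma boxsym_dxi al be M a : boxsym al be M a -> boxsym al be M (dxi a).
Proof.
move=> [sa za]; split; first by move=> k; apply: Ck_dxi; exact: sa.
move=> x xi; rewrite negb_and => H; rewrite /dxi/=.
rewrite derive1E (near_eq_derive (g := cst 0)) ?derive_cst//.
case/orP: H => H; first by near=> y; rewrite /= za// negb_and H.
near=> y; rewrite /= za// negb_and; apply/orP; right.
by near: y; exact: near_notin_itv.
Unshelve. all: by end_near. Qed.

Lemma boxsymM al be M f a : smooth2 f -> boxsym al be M a ->
  boxsym al be M (fun z => f z * a z).
Proof.
move=> sf [sa za]; split; first by move=> k; apply: CkM.
by move=> x xi H; rewrite za// mulr0.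
Qed.

Lemma boxsymD al be M f a : boxsym al be M f -> boxsym al be M a ->
  boxsym al be M (fun z => f z + a z).
Proof.
move=> [sf zf] [sa za]; split; first by move=> k; apply: CkD.
by move=> x xi H; rewrite zf// za// addr0.
Qed.

Lemma boxsymZ al be M (c : R) a : boxsym al be M a -> boxsym al be M (fun z => c * a z).
Proof. by apply: boxsymM => k; exact: Ck_cst. Qed.

Lemma boxsym_xi al be M a : boxsym al be M a -> boxsym al be M (fun z => z.2 * a z).
Proof. by apply: boxsymM => k; exact: Ck_snd. Qed.

(** A function V singular outside [A] may multiply a symbol supported over [A]: near a point
outside the support the product vanishes identically. The induction keeps V and a
general because differentiation replaces them by their derivatives. *)
Lemma Ck_mul_local (A : set R) al be M k (V : R -> R) a : open A ->
  (forall x, al <= x <= be -> A x) -> Dk k A V -> boxsym al be M a ->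
  Ck k (fun z => V z.1 * a z).
Proof.
move=> oA sA.
have ct j (U : R -> R) b : Dk j A U -> boxsym al be M b ->
    continuous (fun z : R * R => U z.1 * b z).
  move=> DU [sb zb] [x xi].
  have [xab|xab] := boolP (al <= x <= be).
    apply: cvgM; last exact: (Ck_cont (sb 0%N)).
    apply: (@cvg_comp _ _ _ fst U _ (nbhs x)); first exact: cvg_fst.
    by apply: is_derive1_continuous; apply: (Dk_is DU); exact: sA.
  have E : U x * b (x, xi) = 0 by rewrite zb ?mulr0// negb_and xab.
  rewrite /continuous_at /= E.
  apply: (cvg_trans _ (@cvg_cst _ (0 : R) _ (nbhs (x, xi)) _)).
  apply: near_eq_cvg.
  have : \forall z \near (x, xi), ~~ (al <= z.1 <= be).
    exact: (@cvg_fst _ _ (nbhs x) (nbhs xi) _ _ (near_notin_itv _)).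
  by apply: filterS => -[y eta] /= Hy; rewrite zb ?mulr0// negb_and Hy.
elim: k V a => [|k IH] V a DV ba; first by split=> //; exact: (ct 0%N).
apply: (Ck_intro (f1 := fun z => derive1 V z.1 * a z + V z.1 * dx a z)
                 (f2 := fun z => V z.1 * dxi a z)).
- exact: (ct k.+1).
- move=> x xi /=; have [xab|xab] := boolP (al <= x <= be).
    apply: is_derive1M; first by apply: (Dk_is DV); exact: sA.
    exact: (Ck_is_dx (x, xi) (ba.1 k.+1)).
  have -> : a (x, xi) = 0 by apply: ba.2; rewrite negb_and xab.
  have -> : dx a (x, xi) = 0 by apply: (boxsym_dx ba).2; rewrite negb_and xab.
  rewrite !mulr0 addr0; apply: (near_eq_is_derive (f := cst 0)).
  near=> y; rewrite ba.2 ?mulr0// negb_and; apply/orP; left.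
  by near: y; exact: near_notin_itv.
- move=> x xi /=; apply: (is_derive1_eq (is_derive1M (is_derive_cst (V x) xi 1)
    (Ck_is_dxi (x, xi) (ba.1 k.+1)))).
  by rewrite mul0r add0r.
- apply: CkD.
    exact: (IH _ _ (proj2 DV) ba).
  exact: (IH _ _ (DkS DV) (boxsym_dx ba)).
- exact: (IH _ _ (DkS DV) (boxsym_dxi ba)).
Unshelve. all: by end_near. Qed.

Lemma boxsym_mulV (A : set R) al be M (V : R -> R) a : open A ->
  (forall x, al <= x <= be -> A x) -> (forall k, Dk k A V) -> boxsym al be M a ->
  boxsym al be M (fun z => V z.1 * a z).
Proof.
move=> oA sA DV ba; split; first by move=> k; exact: Ck_mul_local (DV k) ba.
by move=> x xi H; rewrite ba.2// mulr0.
Qed.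

Lemma compact_box (p q r s : R) : compact (`[p, q] `*` `[r, s] : set (R * R)).
Proof. by apply: compact_setX; exact: segment_compact. Qed.

Lemma compact_bounded_real {T : topologicalType} (A : set T) (f : T -> R) :
  compact A -> {within A, continuous f} -> exists K, 0 <= K /\ forall x, A x -> `|f x| <= K.
Proof.
move=> cA cf.
have /compact_bounded[N [Nr HN]] := continuous_compact cf cA.
exists (`|N| + 1); split; first by rewrite addr_ge0.
move=> x Ax; apply: HN; last by exists x.
by rewrite (le_lt_trans (ler_norm _))// ltrDl.
Qed.

Lemma boxsym_bounded al be M a : boxsym al be M a ->
  exists K, 0 <= K /\ forall z, `|a z| <= K.
Proof.
move=> [sa za].
have [K [K0 HK]] := compact_bounded_real (@compact_box al be (- M) M)
  (continuous_subspaceT (Ck_cont (sa 0%N))).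
exists K; split => // -[x xi].
have [/andP[H1 H2]|H] := boolP ((al <= x <= be) && (- M <= xi <= M)).
  by apply: HK; split; rewrite /= in_itv.
by rewrite za// normr0.
Qed.

End BoxSymbols.

Lemma integrable_EFinZ {R : realType} d (T : measurableType d)
    (mu : {measure set T -> \bar R}) (D : set T) (c : R) (f : T -> R) :
  measurable D -> mu.-integrable D (EFin \o f) ->
  mu.-integrable D (EFin \o (fun x => c * f x)).
Proof.
move=> mD intf; rewrite (_ : _ \o _ = fun x => (c%:E * (EFin \o f) x)%E).
  exact: integrableZl.
by apply/funext => x /=; rewrite EFinM.
Qed.

(** * Integrals of compactly supported functions of one variable *)
Section CompactSupport1.
Context {R : realType}.
Notation mu := (@lebesgue_measure R).
Implicit Types (f F : R -> R) (p q : R).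

Definition vanishes_off p q f := forall x, ~~ (p <= x <= q) -> f x = 0.

Lemma vanishes_off_patch p q f : vanishes_off p q f -> f = f \_ `[p, q].
Proof.
move=> zf; apply/funext => x; rewrite patchE; case: ifPn => //.
by rewrite notin_setE/= in_itv/= => /negP/zf.
Qed.

Lemma cs_integrable p q f : continuous f -> vanishes_off p q f ->
  mu.-integrable setT (EFin \o f).
Proof.
move=> cf zf; rewrite (vanishes_off_patch zf) -restrict_EFin.
apply: (integrable_mkcond _ _).1; first exact: measurable_itv.
apply: continuous_compact_integrable; first exact: segment_compact.
exact: continuous_subspaceT.
Qed.

Lemma cs_Rintegral p q f : vanishes_off p q f ->
  \int[mu]_x f x = \int[mu]_(x in `[p, q]) f x.
Proof. by move=> zf; rewrite [RHS]Rintegral_mkcond -(vanishes_off_patch zf). Qed.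

Lemma cs_Rintegral_le p q f (K : R) : continuous f -> vanishes_off p q f ->
  0 <= K -> (forall x, `|f x| <= K) -> `|\int[mu]_x f x| <= K * `|q - p|.
Proof.
move=> cf zf K0 fK; rewrite (cs_Rintegral zf).
have mI : measurable (`[p, q] : set (measurableTypeR R)) by exact: measurable_itv.
have int_f : mu.-integrable `[p, q] (EFin \o f).
  by apply: continuous_compact_integrable; [exact: segment_compact|exact: continuous_subspaceT].
have int_af : mu.-integrable `[p, q] (EFin \o (fun x => `|f x|)).
  apply: continuous_compact_integrable; first exact: segment_compact.
  by apply: continuous_subspaceT => x; apply: cvg_norm; exact: cf.
have int_K : mu.-integrable `[p, q] (EFin \o (fun _ : R => K)).
  apply: continuous_compact_integrable; first exact: segment_compact.
  by apply: continuous_subspaceT => x; exact: cst_continuous.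
apply: (le_trans (le_normr_Rintegral mI int_f)).
apply: (le_trans (le_Rintegral mI int_af int_K (fun x _ => fK x))).
rewrite Rintegral_cst// ler_wpM2l//= lebesgue_measure_itv/= lte_fin.
by case: ifP => /= _; rewrite ?normr_ge0// ler_norm.
Qed.

Lemma cs_derive_vanishes p q F f : vanishes_off p q F ->
  (forall x : R, is_derive x 1 F (f x)) -> vanishes_off p q f.
Proof.
move=> zF dF x xpq; rewrite -(is_derive1_val (dF x)) derive1E.
rewrite (near_eq_derive (g := cst 0)) ?derive_cst//.
near=> y; rewrite /= zF//; near: y; exact: near_notin_itv.
Unshelve. all: by end_near. Qed.

Lemma derive_oo_LR F f p q : (forall x : R, p <= x <= q -> is_derive x 1 F (f x)) ->
  p < q -> derivable_oo_LRcontinuous F p q.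
Proof.
move=> dF pq; split.
- move=> x; rewrite in_itv/= => /andP[/ltW px /ltW xq].
  by have [] := dF x; rewrite ?px.
- apply: cvg_at_right_filter; apply: (is_derive1_continuous (dF p _)).
  by rewrite lexx ltW.
- apply: cvg_at_left_filter; apply: (is_derive1_continuous (dF q _)).
  by rewrite lexx ltW.
Qed.

Lemma Rintegral_derive F f p q : p < q ->
  (forall x : R, p <= x <= q -> is_derive x 1 F (f x)) ->
  {within `[p, q], continuous f} ->
  \int[mu]_(x in `[p, q]) f x = F q - F p.
Proof.
move=> pq dF cf; rewrite /Rintegral (continuous_FTC2 pq cf (derive_oo_LR dF pq)).
  by rewrite -EFinB.
move=> x; rewrite in_itv/= => /andP[/ltW px /ltW xq].
by rewrite (is_derive1_val (dF x _))// px.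
Qed.

(** Integrating over a slightly larger interval, where F vanishes at both ends, avoids any
discussion of the end points p and q. *)
Lemma cs_Rintegral_derive p q F f : vanishes_off p q F ->
  (forall x : R, is_derive x 1 F (f x)) -> continuous f -> \int[mu]_x f x = 0.
Proof.
move=> zF dF cf.
have zf := cs_derive_vanishes zF dF.
have [p' [q'' [p'p qq' pq]]] : exists p' q' : R, [/\ p' < p, q < q' & p' < q'].
  by exists (Num.min p q - 1), (Num.max p q + 1); split; case: (leP p q) => ?; lra.
have H : \int[mu]_x f x = F q'' - F p'.
  rewrite (@cs_Rintegral p' q'').
    apply: Rintegral_derive => //.
    exact: continuous_subspaceT.
  by move=> x xpq; apply: zf; apply: contra xpq => /andP[? ?]; apply/andP; split; lra.
rewrite H !zF ?subrr// negb_and -!ltNge ?p'p ?qq' ?orbT//.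
Qed.

End CompactSupport1.

(** * Cosine transforms of symbols in the momentum variable *)
Section Osc.
Context {R : realType}.
Notation mu := (@lebesgue_measure R).
Variables (al be M : R).
Implicit Types (a : R * R -> R) (th m s : R).
Local Notation sym := (boxsym al be M).

(** The phase th lets one definition cover cosine and sine transforms: differentiating in s
shifts th by a quarter period. *)
Definition osc th a m s : R := \int[mu]_xi (cos (s * xi + th) * a (m, xi)).

Definition osc_f th a m s : R -> R := fun xi => cos (s * xi + th) * a (m, xi).

Lemma pair_continuous (m : R) : continuous (fun xi : R => (m, xi)).
Proof.
move=> xi; apply: (@cvg_pair _ _ _ (nbhs xi) (nbhs m) (nbhs xi) _ _ _ (cst m) id).
  exact: cvg_cst.
exact: cvg_id.
Qed.

Lemma cos_line_derive th s (xi : R) :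
  is_derive xi 1 (fun y => cos (s * y + th)) (- (s * sin (s * xi + th))).
Proof.
have H := is_derive1_comp_affine (f := cos) (p := th) (q := s) (is_derive_cos (th + s * xi)).
rewrite (_ : (fun y => _) = fun y => cos (th + s * y)); last first.
  by apply/funext => y; rewrite addrC.
by apply: (is_derive1_eq H); rewrite mulrN addrC.
Qed.

Lemma osc_f_continuous th a m s : sym a -> continuous (osc_f th a m s).
Proof.
move=> sa xi; apply: cvgM; first exact: (is_derive1_continuous (cos_line_derive _ _ _)).
apply: (@cvg_comp _ _ _ (fun xi => (m, xi)) a _ (nbhs (m, xi))).
  exact: pair_continuous.
exact: (Ck_cont (sa.1 0%N)).
Qed.

Lemma osc_f_vanishes th a m s : sym a -> vanishes_off (- M) M (osc_f th a m s).
Proof. by move=> sa xi H; rewrite /osc_f sa.2 ?mulr0// negb_and H orbT. Qed.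

Lemma osc_integrable th a m s : sym a -> mu.-integrable setT (EFin \o osc_f th a m s).
Proof.
move=> sa; apply: (@cs_integrable _ (- M) M); first exact: osc_f_continuous.
exact: osc_f_vanishes.
Qed.

Lemma normr_cos_le1 (x : R) : `|cos x| <= 1.
Proof. by rewrite ler_norml cos_geN1 cos_le1. Qed.

(** The bound is uniform in the phase, so that it survives the phase shifts below. *)
Lemma osc_bounded a : sym a -> exists K, 0 <= K /\ forall th m s, `|osc th a m s| <= K.
Proof.
move=> sa; have [K [K0 aK]] := boxsym_bounded sa.
exists (K * `|M - - M|); split; first by rewrite mulr_ge0.
move=> th m s; apply: (@cs_Rintegral_le _ (- M) M (osc_f th a m s)) => //.
- exact: osc_f_continuous.
- exact: osc_f_vanishes.
move=> xi; rewrite normrM -[leRHS]mul1r ler_pM//; exact: normr_cos_le1.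
Qed.

Lemma osc_off a th m s : sym a -> ~~ (al <= m <= be) -> osc th a m s = 0.
Proof.
move=> sa H; rewrite /osc (_ : (fun xi => _) = cst 0); last first.
  by apply/funext => xi; rewrite sa.2 ?mulr0// negb_and H.
by rewrite /Rintegral integral0.
Qed.

Lemma oscD a b th m s : sym a -> sym b ->
  osc th (fun z => a z + b z) m s = osc th a m s + osc th b m s.
Proof.
move=> sa sb; rewrite /osc -RintegralD//; [|exact: osc_integrable..].
by apply: eq_Rintegral => xi _; rewrite mulrDr.
Qed.

Lemma osc_mulV a (V : R -> R) th m s : sym a ->
  osc th (fun z => V z.1 * a z) m s = V m * osc th a m s.
Proof.
move=> sa; rewrite /osc -RintegralZl//; last exact: osc_integrable.
by apply: eq_Rintegral => xi _ /=; rewrite mulrCA.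
Qed.

Lemma oscDpi a th m s : sym a -> osc (th + pi) a m s = - osc th a m s.
Proof.
move=> sa; rewrite /osc -[RHS]mulN1r -RintegralZl//; last exact: osc_integrable.
by apply: eq_Rintegral => xi _ /=; rewrite addrA cosDpi mulN1r mulNr.
Qed.

(** Integration by parts in xi. Read from right to left, it absorbs a factor s into the
symbol. *)
Lemma osc_dxi a th m s : sym a ->
  osc th (dxi a) m s = - s * osc (th + pi / 2) a m s.
Proof.
move=> sa.
have sx := boxsym_dxi sa.
have d (xi : R) : is_derive xi 1 (osc_f th a m s)
    (osc_f th (dxi a) m s xi + s * osc_f (th + pi / 2) a m s xi).
  apply: (is_derive1_eq (is_derive1M (cos_line_derive th s xi)
    (Ck_is_dxi (m, xi) (sa.1 1%N)))).
  by rewrite /osc_f addrA cosDpihalf /=; ring.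
have := cs_Rintegral_derive (osc_f_vanishes th m s sa) d.
rewrite RintegralD//; [|exact: osc_integrable|]; last first.
  by apply: integrable_EFinZ => //; exact: osc_integrable.
rewrite RintegralZl//; last exact: osc_integrable.
move=> H; apply/eqP; rewrite -subr_eq0 mulNr opprK; apply/eqP; apply: H.
move=> xi; apply: cvgD; first exact: osc_f_continuous.
by apply: cvgM; [exact: cvg_cst|exact: osc_f_continuous].
Qed.

(** Each factor s is traded for a derivative of the symbol in xi. *)
Lemma osc_decay a k : sym a ->
  exists K, 0 <= K /\ forall th m s, `|s| ^+ k * `|osc th a m s| <= K.
Proof.
elim: k a => [|k IH] a sa.
  by have [K [K0 HK]] := osc_bounded sa; exists K; split => // th m s; rewrite mul1r.
have [K [K0 HK]] := IH _ (boxsym_dxi sa); exists K; split => // th m s.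
have := HK (th - pi / 2) m s.
by rewrite osc_dxi// subrK normrM normrN mulrA -exprSr.
Qed.

(** Differentiation under the integral sign. Straight lines suffice to
differentiate the kernels in x or in y, since m and s are affine in both; this replaces the
chain rule in two variables. *)
Lemma osc_line a th m0 la s0 si (tau : R) : sym a ->
  is_derive tau 1 (fun tau => osc th a (m0 + la * tau) (s0 + si * tau))
    (la * osc th (dx a) (m0 + la * tau) (s0 + si * tau) +
     si * osc (th + pi / 2) (fun z => z.2 * a z) (m0 + la * tau) (s0 + si * tau)).
Proof.
move=> sa.
have sx := boxsym_dx sa; have sxi := boxsym_xi sa.
pose f (t xi : R) := osc_f th a (m0 + la * t) (s0 + si * t) xi.
pose f' (t xi : R) := la * osc_f th (dx a) (m0 + la * t) (s0 + si * t) xi +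
  si * osc_f (th + pi / 2) (fun z => z.2 * a z) (m0 + la * t) (s0 + si * t) xi.
have df (t xi : R) : is_derive t 1 (f ^~ xi) (f' t xi).
  have d1 : is_derive t 1 (fun t => cos ((s0 + si * t) * xi + th))
      (si * xi * - sin ((s0 + si * t) * xi + th)).
    have H := @is_derive1_comp_affine _ cos (s0 * xi + th) (si * xi) t _
      (is_derive_cos _).
    rewrite (_ : (fun t => _) = fun t => cos (s0 * xi + th + si * xi * t)); last first.
      by apply/funext => u; congr cos; ring.
    by apply: (is_derive1_eq H); congr (_ * - sin _); ring.
  have d2 : is_derive t 1 (fun t => a (m0 + la * t, xi)) (la * dx a (m0 + la * t, xi)).
    apply: (@is_derive1_comp_affine _ (fun x => a (x, xi))).
    exact: (Ck_is_dx (m0 + la * t, xi) (sa.1 1%N)).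
  apply: (is_derive1_eq (is_derive1M d1 d2)).
  by rewrite /f' /osc_f addrA cosDpihalf /=; ring.
have [K1 [K10 HK1]] := boxsym_bounded sx.
have [K2 [K20 HK2]] := boxsym_bounded sxi.
pose K := `|la| * K1 + `|si| * K2.
have K0 : 0 <= K by rewrite addr_ge0 ?mulr_ge0.
(* the dominating function: a constant on the momentum support *)
pose G (xi : R) : R := K * \1_(`[- M, M]) xi.
have G0 xi : 0 <= G xi by rewrite mulr_ge0.
have intG : mu.-integrable setT (EFin \o G).
  apply: integrable_EFinZ => //.
  exact: (integrable_indic_itv (- M) M true false).
have Gub t xi : `|f' t xi| <= G xi.
  rewrite /G indicE; have [|] := boolP (xi \in _); last first.
    rewrite notin_setE/= in_itv/= => /negP H.
    by rewrite /f' !osc_f_vanishes// !mulr0 addr0 normr0.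
  move=> _; rewrite mulr1; apply: (le_trans (ler_normD _ _)).
  rewrite /K !normrM lerD// ler_wpM2l// -[leRHS]mul1r ler_pM//;
    solve [exact: normr_cos_le1 | by rewrite -normrM; exact: HK2].
have int_f x : `]tau - 1, tau + 1[%classic x -> mu.-integrable setT (EFin \o f x).
  by move=> _; exact: osc_integrable.
have tauI : (`]tau - 1, tau + 1[%classic : set R) tau by rewrite /= in_itv/=; lra.
have der x y : `]tau - 1, tau + 1[%classic x -> [set: R] y -> derivable (f^~ y) x 1.
  by move=> _ _; have [] := df x y.
have Gub' x y : `]tau - 1, tau + 1[%classic x -> [set: R] y ->
    `|partial1of2 f x y| <= G y.
  by move=> _ _; rewrite /partial1of2 (is_derive1_val (df x y)); exact: Gub.
have D := derivable_under_integral measurableT tauI int_f der G0 intG Gub'.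
have E := differentiation_under_integral measurableT tauI int_f der G0 intG Gub'.
apply: DeriveDef; first exact: D.
rewrite -derive1E E.
transitivity (\int[mu]_xi f' tau xi).
  by apply: eq_Rintegral => y _; rewrite /partial1of2 (is_derive1_val (df tau y)).
rewrite RintegralD//.
- by rewrite !RintegralZl//; exact: osc_integrable.
- by apply: integrable_EFinZ => //; exact: osc_integrable.
- by apply: integrable_EFinZ => //; exact: osc_integrable.
Qed.

(** Joint regularity in (m, s), from the mean value inequality along the segment. *)
Lemma osc_lipschitz a : sym a -> exists K, 0 <= K /\
  forall th m s m' s', `|osc th a m' s' - osc th a m s| <= K * (`|m' - m| + `|s' - s|).
Proof.
move=> sa.
have [K1 [K10 HK1]] := osc_bounded (boxsym_dx sa).
have [K2 [K20 HK2]] := osc_bounded (boxsym_xi sa).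
exists (K1 + K2); split; first by rewrite addr_ge0.
move=> th m s m' s'.
have := @mean_value_le _ (fun t => osc th a (m + (m' - m) * t) (s + (s' - s) * t)) _ 0 1
  (K1 * `|m' - m| + K2 * `|s' - s|) (fun t _ => osc_line th m (m' - m) s (s' - s) t sa).
rewrite !mulr1 !mulr0 !addr0 !(addrC m) !(addrC s) !subrK subr0 normr1 mulr1 => H.
apply: le_trans (H _) _ => [t _|].
  apply: (le_trans (ler_normD _ _)).
  by rewrite !normrM lerD// mulrC ler_wpM2r.
by rewrite mulrDl !mulrDr; have := mulr_ge0 K10 (normr_ge0 (s' - s));
  have := mulr_ge0 K20 (normr_ge0 (m' - m)); lra.
Qed.

Lemma osc_continuous a th : sym a -> continuous (fun z : R * R => osc th a z.1 z.2).
Proof.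
move=> sa; have [K [K0 HK]] := osc_lipschitz sa => -[m s].
have c1 : z.1 @[z --> (m, s)] --> m by exact: cvg_fst.
have c2 : z.2 @[z --> (m, s)] --> s by exact: cvg_snd.
apply/cvgrPdist_le => /= e e0.
have K1 : 0 < K + 1 by rewrite ltr_wpDl.
have e1 : 0 < e / (2 * (K + 1)) by rewrite divr_gt0// mulr_gt0.
move/cvgrPdist_lt : c1 => /(_ _ e1) c1.
move/cvgrPdist_lt : c2 => /(_ _ e1) c2.
near=> z.
rewrite distrC (le_trans (HK _ _ _ _ _))//.
have H1 : `|m - z.1| < e / (2 * (K + 1)) by near: z.
have H2 : `|s - z.2| < e / (2 * (K + 1)) by near: z.
rewrite distrC in H1; rewrite distrC in H2.
apply: le_trans (_ : (K + 1) * (e / (2 * (K + 1)) + e / (2 * (K + 1))) <= _).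
  by rewrite ler_pM// ?addr_ge0// ?lerDl// lerD// ltW.
rewrite le_eqVlt; apply/orP; left; apply/eqP; field; lra.
Unshelve. all: by end_near. Qed.

End Osc.

(** * Borel measurability on the plane *)
Section PlaneMeasurability.
Context {R : realType}.

(** An open set of the plane is a countable union of squares with rational data. *)
Lemma open_plane_measurable (O : set (R * R)) : open O -> measurable (O : set (plane R)).
Proof.
move=> oO.
pose box (q1 q2 r : rat) : set (R * R) :=
  [set z | `|z.1 - ratr q1| < ratr r] `&` [set z | `|z.2 - ratr q2| < ratr r].
pose F q1 q2 r := if pselect (box q1 q2 r `<=` O) then box q1 q2 r else set0.
have -> : O = \bigcup_q1 \bigcup_q2 \bigcup_r F q1 q2 r.
  apply/seteqP; split => [[x y] Oxy|z [q1 _ [q2 _ [r _]]]]; last first.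
    by rewrite /F; case: (pselect _) => [bO|//]; exact: bO.
  have := open_nbhs_nbhs (conj oO Oxy) => -[[A B]] /= [nA nB] AB.
  have /nbhs_ballP[e1 /= e10 He1] := nA; have /nbhs_ballP[e2 /= e20 He2] := nB.
  pose e := Num.min e1 e2; have e0 : 0 < e by rewrite lt_min e10.
  have /rat_in_itvoo[r /itvP rI] : 0 < e / 2 by rewrite divr_gt0.
  have r0 : 0 < ratr r :> R by rewrite rI.
  have re : ratr r < e / 2 by rewrite rI.
  have /rat_in_itvoo[q1 /itvP q1I] : x < x + ratr r by rewrite ltrDl.
  have /rat_in_itvoo[q2 /itvP q2I] : y < y + ratr r by rewrite ltrDl.
  have hq1 : x < ratr q1 < x + ratr r by rewrite !q1I.
  have hq2 : y < ratr q2 < y + ratr r by rewrite !q2I.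
  have eq1 : e <= e1 by rewrite ge_min lexx.
  have eq2 : e <= e2 by rewrite ge_min lexx orbT.
  have bO : box q1 q2 r `<=` O.
    move=> [u v] [/=]; rewrite !ltr_norml => /andP[? ?] /andP[? ?]; apply: AB; split => /=.
      by apply: He1; rewrite /ball/= ltr_norml; lra.
    by apply: He2; rewrite /ball/= ltr_norml; lra.
  exists q1 => //; exists q2 => //; exists r => //; rewrite /F; case: (pselect _) => [?|nbO] /=; last by case: (nbO bO).
  by split => /=; rewrite ltr_norml; lra.
apply: bigcupT_measurable_rat => q1; apply: bigcupT_measurable_rat => q2.
apply: bigcupT_measurable_rat => r; rewrite /F; case: (pselect _) => [?|?] /=; last exact: measurable0.
have -> : box q1 q2 r = [set x | `|x - ratr q1| < ratr r] `*` [set y | `|y - ratr q2| < ratr r].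
  by [].
have m1 (q : rat) : measurable ([set x | `|x - ratr q| < ratr r] : set (measurableTypeR R)).
  rewrite (_ : [set x | _] = `]ratr q - ratr r, ratr q + ratr r[%classic).
    exact: measurable_itv.
  by apply/seteqP; split => x /=; rewrite in_itv/= ltr_distl.
exact: measurableX.
Qed.

Lemma continuous_plane_measurable (f : R * R -> R) : continuous f ->
  measurable_fun [set: plane R] f.
Proof.
move=> /continuousP cf; apply: (measurability _ (RGenOpens.measurableE R)).
move=> _ [_ [a [b ->] <-]]; rewrite setTI; apply: open_plane_measurable.
exact/cf/interval_open.
Qed.

Lemma measurable_comp_fst (f : R -> R) : measurable_fun [set: measurableTypeR R] f ->
  measurable_fun [set: plane R] (fun z => f z.1).
Proof. by move=> mf; apply: (measurableT_comp mf); exact: measurable_fst. Qed.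

Lemma measurable_comp_snd (f : R -> R) : measurable_fun [set: measurableTypeR R] f ->
  measurable_fun [set: plane R] (fun z => f z.2).
Proof. by move=> mf; apply: (measurableT_comp mf); exact: measurable_snd. Qed.

End PlaneMeasurability.

(** * Quadratic forms of kernels concentrated near the diagonal *)
Section Schur.
Context {R : realType}.
Notation mu := (@lebesgue_measure R).
Notation mu2 := (mu \x mu)%E.

(** This profile is integrable in each variable, with integral of order h, and dominates the
kernels below. *)
Definition weight (h : R) (z : R * R) : R := (1 + ((z.1 - z.2) / h) ^+ 2)^-1.

Lemma weight_den_gt0 h z : 0 < 1 + ((z.1 - z.2) / h) ^+ 2 :> R.
Proof. by rewrite ltr_pwDl// sqr_ge0. Qed.

Lemma weight_ge0 h z : 0 <= weight h z.
Proof. by rewrite invr_ge0 ltW// weight_den_gt0. Qed.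

Lemma weight_le1 h z : weight h z <= 1.
Proof. by rewrite invf_le1 ?weight_den_gt0// lerDl sqr_ge0. Qed.

Lemma weight_sym h x y : weight h (x, y) = weight h (y, x).
Proof. by rewrite /weight/= -opprB mulNr sqrrN. Qed.

Lemma weight_continuous h : continuous (weight h).
Proof.
move=> z; apply: cvgV; first by rewrite gt_eqF// weight_den_gt0.
apply: cvgD; first exact: cvg_cst.
apply: (@cvg_comp _ _ _ (fun z : R * R => (z.1 - z.2) / h) (fun x => x ^+ 2) _
  (nbhs ((z.1 - z.2) / h))); last exact: exprn_continuous.
apply: cvgM; last exact: cvg_cst.
by apply: cvgB; [exact: cvg_fst|exact: cvg_snd].
Qed.

Lemma integral_oneDsqrT : (\int[mu]_x ((oneDsqr x)^-1)%:E = (pi : R)%:E)%E.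
Proof.
rewrite (@ge0_symfun_integralT _ (fun x => (oneDsqr x)^-1)).
- rewrite -set_itvcy integral0y_oneDsqr -EFinM; congr EFin; by field.
- by move=> x; rewrite invr_ge0 (le_trans ler01).
- exact: continuous_oneDsqrV.
- by move=> x; rewrite /= /oneDsqr sqrrN.
Qed.

Lemma integral_weight (h x : R) : 0 < h -> (\int[mu]_y (weight h (x, y))%:E = (h * pi)%:E)%E.
Proof.
move=> h0.
pose F (y : R) := - (x / h) + h^-1 * y.
have dF (y : R) : is_derive y 1 F h^-1 by exact: is_derive1_affine.
have F' : F^`()%classic = cst h^-1 by apply/funext => y; exact: is_derive1_val.
have hV0 : 0 < h^-1 by rewrite invr_gt0.
have := @increasing_ge0_integration_by_substitutionT R F (fun x => (oneDsqr x)^-1).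
rewrite F' integral_oneDsqrT => H.
have {}H : (pi%:E = \int[mu]_y ((oneDsqr (F y))^-1 * h^-1)%:E)%E.
  apply: H.
  - by move=> u v uv; rewrite /F ltrD2l ltr_pM2l.
  - by move=> u; exact: cst_continuous.
  - exact: is_cvg_cst.
  - exact: is_cvg_cst.
  - by move=> u; have [] := dF u.
  - apply: (@cvg_comp _ _ _ (fun y => h^-1 * y) (fun y => - (x / h) + y) _ -oo).
      by apply: gt0_cvgMrNy => //; exact: cvg_id.
    exact: cvg_addrl_Ny.
  - apply: (@cvg_comp _ _ _ (fun y => h^-1 * y) (fun y => - (x / h) + y) _ +oo).
      by apply: gt0_cvgMry => //; exact: cvg_id.
    exact: cvg_addrl.
  - exact: continuous_oneDsqrV.
  - by move=> u; rewrite invr_ge0 (le_trans ler01).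
rewrite EFinM H -ge0_integralZl//=.
- apply: eq_integral => y _; rewrite /weight -EFinM /F /oneDsqr; congr EFin.
  rewrite mulrCA divff ?gt_eqF// mulr1.
  congr (_^-1); congr (1 + _) => /=.
  rewrite (_ : - (x / h) + h^-1 * y = - ((x - y) / h)) ?sqrrN//.
  by rewrite mulrBl opprB addrC mulrC.
- apply/measurable_EFinP; apply: continuous_measurable_fun => y.
  apply: cvgM; last exact: cvg_cst.
  apply: (@cvg_comp _ _ _ F (fun x => (oneDsqr x)^-1) _ (nbhs (F y))).
    exact: (is_derive1_continuous (dF y)).
  exact: continuous_oneDsqrV.
- move=> y _; rewrite lee_fin; apply: mulr_ge0; last exact: ltW.
  by rewrite invr_ge0 (le_trans ler01 (oneDsqr_ge1 _)).
- by rewrite lee_fin ltW.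
Qed.

Variables (g : R -> R) (h : R).
Hypothesis mg : measurable_fun [set: measurableTypeR R] g.
Hypothesis g1 : (\int[mu]_x ((g x) ^+ 2)%:E = 1)%E.
Hypothesis h0 : 0 < h.

Definition quad (k : R * R -> R) : R := \int[mu2]_z (k z * (g z.1 * g z.2)).

Definition dominated (K : R) (k : R * R -> R) :=
  measurable_fun [set: plane R] k /\ forall z, `|k z| <= K * weight h z.

Let mw : measurable_fun [set: plane R] (weight h).
Proof. exact: continuous_plane_measurable (@weight_continuous h). Qed.

Let mg2 : measurable_fun [set: measurableTypeR R] (fun x => g x ^+ 2).
Proof. exact: measurable_funX. Qed.

(** Tonelli: the integral of the weight in the other variable is h pi, whatever the first
variable. *)
Lemma integral_weight_fst :
  (\int[mu2]_z (weight h z * g z.1 ^+ 2)%:E = (h * pi)%:E)%E.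
Proof.
rewrite fubini_tonelli1; last 2 first.
- apply/measurable_EFinP; apply: measurable_funM => //.
  exact: (measurable_comp_fst mg2).
- by move=> z; rewrite lee_fin mulr_ge0 ?weight_ge0 ?sqr_ge0.
rewrite /fubini_F.
transitivity (\int[mu]_x ((h * pi)%:E * (g x ^+ 2)%:E))%E.
  apply: eq_integral => x _ /=; rewrite -(integral_weight x h0).
  rewrite -ge0_integralZr//=.
  - by apply/measurable_EFinP; apply: (measurableT_comp mw); exact: measurable_pair1.
  - by move=> y _; rewrite lee_fin weight_ge0.
  - by rewrite lee_fin sqr_ge0.
rewrite ge0_integralZl_EFin//.
- by rewrite g1 mule1.
- by move=> x _; rewrite lee_fin sqr_ge0.
- exact/measurable_EFinP.
- by rewrite mulr_ge0 ?pi_ge0 ?ltW.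
Qed.

Lemma integral_weight_snd :
  (\int[mu2]_z (weight h z * g z.2 ^+ 2)%:E = (h * pi)%:E)%E.
Proof.
rewrite fubini_tonelli2; last 2 first.
- apply/measurable_EFinP; apply: measurable_funM => //.
  exact: (measurable_comp_snd mg2).
- by move=> z; rewrite lee_fin mulr_ge0 ?weight_ge0 ?sqr_ge0.
rewrite /fubini_G.
transitivity (\int[mu]_x ((h * pi)%:E * (g x ^+ 2)%:E))%E.
  apply: eq_integral => x _ /=; rewrite -(integral_weight x h0).
  rewrite -ge0_integralZr//=.
  - by apply: eq_integral => y _; rewrite weight_sym.
  - apply/measurable_EFinP; apply: (measurableT_comp mw); exact: measurable_pair1.
  - by move=> y _; rewrite lee_fin weight_ge0.
  - by rewrite lee_fin sqr_ge0.
rewrite ge0_integralZl_EFin//.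
- by rewrite g1 mule1.
- by move=> x _; rewrite lee_fin sqr_ge0.
- exact/measurable_EFinP.
- by rewrite mulr_ge0 ?pi_ge0 ?ltW.
Qed.

Section Dominated.
Variables (K : R) (k : R * R -> R).
Hypothesis dk : dominated K k.

Let mkgg : measurable_fun [set: plane R] (fun z => k z * (g z.1 * g z.2)).
Proof.
apply: measurable_funM; first exact: dk.1.
by apply: measurable_funM; [exact: (measurable_comp_fst mg)|exact: (measurable_comp_snd mg)].
Qed.

Let K0 : 0 <= K.
Proof.
have := le_trans (normr_ge0 _) (dk.2 (0, 0)).
by rewrite /weight subrr mul0r expr0n addr0 invr1 mulr1.
Qed.

(** Schur test: |g(x) g(y)| is at most the mean of g(x)^2 and g(y)^2. *)
Lemma quad_abs_le :
  (\int[mu2]_z `|(k z * (g z.1 * g z.2))%:E| <= (K * (h * pi))%:E)%E.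
Proof.
pose F1 (z : plane R) := (weight h z * g z.1 ^+ 2)%:E.
pose F2 (z : plane R) := (weight h z * g z.2 ^+ 2)%:E.
have mF1 : measurable_fun [set: plane R] F1.
  apply/measurable_EFinP; apply: measurable_funM => //.
  exact: (measurable_comp_fst mg2).
have mF2 : measurable_fun [set: plane R] F2.
  apply/measurable_EFinP; apply: measurable_funM => //.
  exact: (measurable_comp_snd mg2).
have F10 z : (0 <= F1 z)%E by rewrite lee_fin mulr_ge0 ?weight_ge0 ?sqr_ge0.
have F20 z : (0 <= F2 z)%E by rewrite lee_fin mulr_ge0 ?weight_ge0 ?sqr_ge0.
have K20 : 0 <= K / 2 by rewrite divr_ge0.
have -> : ((K * (h * pi))%:E = \int[mu2]_z ((K / 2)%:E * (F1 z + F2 z)))%E.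
  rewrite ge0_integralZl_EFin//.
  - rewrite ge0_integralD// integral_weight_fst integral_weight_snd -EFinD -EFinM.
    by congr EFin; field.
  - by move=> z _; rewrite adde_ge0.
  - exact: emeasurable_funD.
apply: ge0_le_integral => //.
- by apply: measurableT_comp => //; exact/measurable_EFinP.
- apply: measurable_funeM; exact: emeasurable_funD.
- move=> z _; rewrite -EFinD -EFinM lee_fin /= normrM.
  apply: (le_trans (ler_wpM2r (normr_ge0 _) (dk.2 z))).
  have AM : `|g z.1 * g z.2| <= (g z.1 ^+ 2 + g z.2 ^+ 2) / 2.
    have := sqr_ge0 (`|g z.1| - `|g z.2|).
    by rewrite normrM sqrrB !real_normK ?num_real//; lra.
  apply: (le_trans (ler_wpM2l _ AM)); first by rewrite mulr_ge0// weight_ge0.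
  by rewrite le_eqVlt; apply/orP; left; apply/eqP; field.
Qed.

Lemma quad_integrable : mu2.-integrable setT (EFin \o (fun z => k z * (g z.1 * g z.2))).
Proof.
apply/integrableP; split; first exact/measurable_EFinP.
exact: (le_lt_trans quad_abs_le (ltry _)).
Qed.

Lemma quad_le : `|quad k| <= K * (h * pi).
Proof.
rewrite -lee_fin; apply: le_trans quad_abs_le.
rewrite EFin_normr_Rintegral//; last exact: quad_integrable.
by apply: le_abse_integral => //; exact/measurable_EFinP.
Qed.

Let int_w x : mu.-integrable setT (fun y => (weight h (x, y))%:E).
Proof.
apply/integrableP; split.
  by apply/measurable_EFinP; apply: (measurableT_comp mw); exact: measurable_pair1.
under eq_integral => y _ do rewrite /= ger0_norm ?weight_ge0//.
by rewrite integral_weight// ltry.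
Qed.

Let int_g2 : mu.-integrable setT (fun y => (g y ^+ 2)%:E).
Proof.
apply/integrableP; split; first exact/measurable_EFinP.
under eq_integral => y _ do rewrite /= ger0_norm ?sqr_ge0//.
by rewrite g1 ltry.
Qed.

(** Integrability in y for every x, and not only for almost every x, as the iterated
real-valued integrals of the pairing require. *)
Lemma section_integrable (f : R -> R) x : measurable_fun [set: measurableTypeR R] f ->
  (forall y, `|f y| <= K * weight h (x, y)) ->
  mu.-integrable setT (EFin \o (fun y => f y * g y)).
Proof.
move=> mf fK.
apply: (@le_integrable _ _ _ mu _ _ _ (fun y => K%:E * ((weight h (x, y))%:E + (g y ^+ 2)%:E))%E) => //.
- by apply/measurable_EFinP; exact: measurable_funM.
- move=> y _; rewrite -EFinD -EFinM lee_fin /= [leLHS]normrM.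
  apply: (le_trans (ler_wpM2r (normr_ge0 _) (fK y))).
  rewrite -mulrA [leRHS]ger0_norm; last by rewrite mulr_ge0// addr_ge0 ?weight_ge0 ?sqr_ge0.
  rewrite ler_wpM2l//.
  apply: (@le_trans _ _ (weight h (x, y) * (1 + g y ^+ 2))).
    rewrite ler_wpM2l ?weight_ge0// -[X in _ <= _ + X]real_normK ?num_real//.
    by have := sqr_ge0 (`|g y| - 1); rewrite sqrrB1; have := normr_ge0 (g y);
      have := sqr_ge0 `|g y|; lra.
  by rewrite mulrDr mulr1 lerD2l -[leRHS]mul1r ler_wpM2r ?sqr_ge0// weight_le1.
- by apply: integrableZl => //; apply: integrableD.
Qed.

Lemma quad_iter12 : quad k = \int[mu]_x ((\int[mu]_y (k (x, y) * g y)) * g x).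
Proof.
rewrite /quad /Rintegral -(integral12_prod_meas1 quad_integrable) /fubini_F; congr fine.
apply: eq_integral => x _ /=.
have int_kx : mu.-integrable setT (EFin \o (fun y => k (x, y) * g y)).
  apply: (section_integrable (x := x)); last by move=> y; exact: dk.2.
  by apply: (measurableT_comp dk.1); exact: measurable_pair1.
rewrite mulrC EFinM fineK; last exact: integrable_fin_num.
rewrite -integralZl//; apply: eq_integral => y _; rewrite -EFinM; congr EFin.
by rewrite mulrCA.
Qed.

Lemma quad_iter21 : quad k = \int[mu]_y ((\int[mu]_x (k (x, y) * g x)) * g y).
Proof.
rewrite /quad /Rintegral -(integral21_prod_meas1 quad_integrable) /fubini_G; congr fine.
apply: eq_integral => y _ /=.
have int_ky : mu.-integrable setT (EFin \o (fun x => k (x, y) * g x)).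
  apply: (section_integrable (x := y)); last by move=> x; rewrite weight_sym; exact: dk.2.
  by apply: (measurableT_comp dk.1); exact: measurable_pair2.
rewrite mulrC EFinM fineK; last exact: integrable_fin_num.
rewrite -integralZl//; apply: eq_integral => x _; rewrite -EFinM; congr EFin.
by rewrite mulrA mulrC.
Qed.

End Dominated.

Lemma quadB K K' k k' : dominated K k -> dominated K' k' ->
  quad (fun z => k z - k' z) = quad k - quad k'.
Proof.
move=> dk dk'; rewrite /quad -RintegralB//.
- by apply: eq_Rintegral => z _; rewrite mulrBl.
- exact: quad_integrable dk.
- exact: quad_integrable dk'.
Qed.

End Schur.

(** * Integration by parts against a solution of the equation *)

Lemma continuous_compose {T U W : topologicalType} (f : T -> U) (g : U -> W) :
  continuous f -> continuous g -> continuous (fun x => g (f x)).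
Proof. by move=> cf cg x; apply: continuous_comp; [exact: cf|exact: cg]. Qed.

Section IBP.
Context {R : realType}.
Notation mu := (@lebesgue_measure R).

Definition half_restrict (f : R -> R) : R -> R := f \_ `[0, +oo[.

Lemma half_restrictE f (x : R) : 0 <= x -> half_restrict f x = f x.
Proof. by move=> x0; rewrite /half_restrict patchE mem_set//= in_itv/= x0. Qed.

(** The equation on the open half-line, with ordinary derivatives; G' is a name for the
derivative of G. *)
Definition solves (h : R) (V : R -> R) (E : R) (G G' : R -> R) : Prop :=
  forall x : R, 0 < x -> [/\ {for x, continuous V}, is_derive x 1 G (G' x) &
    is_derive x 1 G' ((V x - E) / h ^+ 2 * G x)].

(** Green's formula for f and G, with f compactly supported away from 0: the integrand
is the derivative of h^2 (f' G - f G'). *)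
Lemma ibp_solution h V E G G' (f f1 f2 : R -> R) (p q : R) : h != 0 -> 0 < p ->
  solves h V E G G' -> vanishes_off p q f ->
  (forall y : R, is_derive y 1 f (f1 y)) -> (forall y : R, is_derive y 1 f1 (f2 y)) ->
  continuous f2 ->
  \int[mu]_y ((h ^+ 2 * f2 y - f y * (half_restrict V y - E)) * half_restrict G y) = 0.
Proof.
move=> h0 p0 sG zf df df1 cf2.
have zf1 := cs_derive_vanishes zf df.
have zf2 := cs_derive_vanishes zf1 df1.
have [p' [q' [p'0 p'p qq' pq]]] : exists p' q' : R, [/\ 0 < p', p' < p, q < q' & p' < q'].
  by exists (p / 2), (Num.max p q + 1); split; case: (leP p q) => ?; lra.
have zz y : ~~ (p' <= y <= q') -> ~~ (p <= y <= q).
  by apply: contra => /andP[? ?]; apply/andP; split; lra.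
rewrite (@cs_Rintegral _ p' q'); last first.
  by move=> y /zz H; rewrite zf// zf2// mulr0 mul0r subr0 mul0r.
pose F y := h ^+ 2 * (f1 y * G y - f y * G' y).
pose k y := (h ^+ 2 * f2 y - f y * (V y - E)) * G y.
transitivity (\int[mu]_(y in `[p', q']) k y).
  apply: eq_Rintegral => y; rewrite inE/= in_itv/= => /andP[p'y _].
  by rewrite !half_restrictE// ltW// (lt_le_trans p'0).
have dF (y : R) : p' <= y <= q' -> is_derive y 1 F (k y).
  move=> /andP[p'y _]; have [_ dG dG'] := sG y (lt_le_trans p'0 p'y).
  have d1 := is_derive1M (df1 y) dG; have d2 := is_derive1M (df y) dG'.
  apply: (is_derive1_eq (is_derive1M (is_derive_cst (h ^+ 2) y 1)
    (is_derive1D d1 (is_derive1N d2)))).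
  by rewrite /k /cst; field.
rewrite (Rintegral_derive pq dF).
  by rewrite /F !zf ?zf1 ?mul0r ?subrr ?mulr0// negb_and -!ltNge ?p'p ?qq' ?orbT.
apply: continuous_in_subspaceT => y; rewrite inE/= in_itv/= => /andP[p'y _].
have [cV dG _] := sG y (lt_le_trans p'0 p'y).
apply: cvgM; last exact: (is_derive1_continuous dG).
apply: cvgB; first by apply: cvgM; [exact: cvg_cst|exact: cf2].
apply: cvgM; first exact: (is_derive1_continuous (df y)).
by apply: cvgB; [exact: cV|exact: cvg_cst].
Qed.

End IBP.

(** * Cut-off kernels *)
Section CutKernels.
Context {R : realType}.
Variables (al be M : R).
Local Notation sym := (boxsym al be M).

(** [chi1] and [chi2] are the first two derivatives of [chi]; the bound on 1 - chi says that
chi equals 1 at 0, with a Lipschitz error. *)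
Definition is_cutoff (X : R) (chi chi1 chi2 : R -> R) : Prop :=
  [/\ forall r : R, is_derive r 1 chi (chi1 r), forall r : R, is_derive r 1 chi1 (chi2 r),
      continuous chi2,
      forall r, [/\ `|chi r| <= X, `|chi1 r| <= X, `|chi2 r| <= X &
        `|1 - chi r| <= X * `|r|] &
      vanishes_off (-1) 1 chi].

Lemma dx_xi a : sym a -> dx (fun z => z.2 * a z) = (fun z => z.2 * dx a z).
Proof.
move=> sa; apply/funext => -[x xi]; rewrite /dx /=.
apply: (is_derive1_val (is_derive1_eq (is_derive1M (is_derive_cst xi x 1)
  (Ck_is_dx (x, xi) (sa.1 1%N))) _)).
by rewrite mul0r add0r.
Qed.

Variables (X : R) (chi chi1 chi2 : R -> R).
Hypothesis cut : is_cutoff X chi chi1 chi2.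

(** The cut-off kernel chi(r) A(m, s), followed by its first two derivatives along a line
with direction (la, si, nu) in the coordinates (m, s, r). *)
Definition cut0 th a (m s r : R) : R := chi r * osc th a m s.

Definition cut1 la si nu th a (m s r : R) : R :=
  nu * chi1 r * osc th a m s
  + chi r * (la * osc th (dx a) m s + si * osc (th + pi / 2) (fun z => z.2 * a z) m s).

Definition cut2 la si nu th a (m s r : R) : R :=
  nu ^+ 2 * chi2 r * osc th a m s
  + 2 * nu * chi1 r *
    (la * osc th (dx a) m s + si * osc (th + pi / 2) (fun z => z.2 * a z) m s)
  + chi r * (la ^+ 2 * osc th (dx (dx a)) m s
             + 2 * la * si * osc (th + pi / 2) (fun z => z.2 * dx a z) m s
             + si ^+ 2 * osc (th + pi) (fun z => z.2 * (z.2 * a z)) m s).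

Section Lines.
Variables (m0 la s0 si r0 nu th : R) (a : R * R -> R).
Hypothesis sa : sym a.

Lemma cut0_line (y : R) :
  is_derive y 1 (fun y => cut0 th a (m0 + la * y) (s0 + si * y) (r0 + nu * y))
    (cut1 la si nu th a (m0 + la * y) (s0 + si * y) (r0 + nu * y)).
Proof.
have [d1 _ _ _ _] := cut.
apply: (is_derive1_eq (is_derive1M (is_derive1_comp_affine (d1 _))
  (osc_line th m0 la s0 si y sa))).
by rewrite /cut1; ring.
Qed.

Lemma cut1_line (y : R) :
  is_derive y 1 (fun y => cut1 la si nu th a (m0 + la * y) (s0 + si * y) (r0 + nu * y))
    (cut2 la si nu th a (m0 + la * y) (s0 + si * y) (r0 + nu * y)).
Proof.
have [d1 d2 _ _ _] := cut.
have sxi := boxsym_xi sa; have sx := boxsym_dx sa.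
have o1 := is_derive1M (is_derive_cst la y 1) (osc_line th m0 la s0 si y sx).
have o2 := is_derive1M (is_derive_cst si y 1) (osc_line (th + pi / 2) m0 la s0 si y sxi).
have c1 := is_derive1M (is_derive1M (is_derive_cst nu y 1)
  (is_derive1_comp_affine (d2 (r0 + nu * y)))) (osc_line th m0 la s0 si y sa).
have c2 := is_derive1M (is_derive1_comp_affine (d1 (r0 + nu * y))) (is_derive1D o1 o2).
apply: (is_derive1_eq (is_derive1D c1 c2)).
rewrite /cut2 /cst dx_xi// -(addrA th) -splitr.
do ![move: (osc _ _ _ _) => ?]; move: (chi _) (chi1 _) (chi2 _) => ? ? ?; ring.
Qed.

End Lines.

Variables (de t h : R).
Hypotheses (de0 : 0 < de) (t01 : 0 <= t <= 1) (h0 : 0 < h).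

(** Coordinates (m, s, r) of a point of the plane: the base point of the quantization, and the
offset x - y measured on the scale h and on the fixed scale de. *)
Definition diag_coord (F : R -> R -> R -> R) (z : R * R) : R :=
  F (t * z.1 + (1 - t) * z.2) ((z.1 - z.2) / h) ((z.1 - z.2) / de).

Lemma diag_coord_snd F x y : diag_coord F (x, y) =
  F (t * x + (1 - t) * y) (x / h + - h^-1 * y) (x / de + - de^-1 * y).
Proof. by rewrite /diag_coord /= !mulrBl; congr F; ring. Qed.

Lemma diag_coord_fst F x y : diag_coord F (x, y) =
  F ((1 - t) * y + t * x) (- (y / h) + h^-1 * x) (- (y / de) + de^-1 * x).
Proof. by rewrite /diag_coord /= !mulrBl; congr F; ring. Qed.

(** m lies between x and y. *)
Lemma near_diag x y r : 0 <= r -> `|x - y| <= r ->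
  (`|x - (t * x + (1 - t) * y)| <= r) /\ (`|y - (t * x + (1 - t) * y)| <= r).
Proof.
move: t01 => /andP[t0 t1] r0 xy; split.
  rewrite (_ : x - _ = (1 - t) * (x - y)); last by ring.
  by rewrite normrM ger0_norm ?subr_ge0//; apply: le_trans xy; rewrite ler_piMl//; lra.
rewrite (_ : y - _ = - (t * (x - y))); last by ring.
by rewrite normrN normrM ger0_norm//; apply: le_trans xy; rewrite ler_piMl.
Qed.

Lemma chi_off r : 1 < `|r| -> [/\ chi r = 0, chi1 r = 0 & chi2 r = 0].
Proof.
have [d1 d2 _ _ zc] := cut => r1.
have zc1 := cs_derive_vanishes zc d1; have zc2 := cs_derive_vanishes zc1 d2.
have H : ~~ (- 1 <= r <= 1) by rewrite -ler_norml -ltNge.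
by split; [exact: zc|exact: zc1|exact: zc2].
Qed.

(** The base point m is in [al, be] and lies between x and y, which are within de of each
other; hence both are within de of [al, be]. *)
Lemma cut_loc th a x y : sym a -> diag_coord (cut0 th a) (x, y) != 0 ->
  [/\ al <= t * x + (1 - t) * y <= be, `|x - y| <= de,
      al - de <= x <= be + de & al - de <= y <= be + de].
Proof.
move=> sa; rewrite /diag_coord /cut0 /= => H.
have mI : al <= t * x + (1 - t) * y <= be.
  by apply: contraNT H => H; rewrite (@osc_off _ al be M _ _ _ _ sa H) mulr0 eqxx.
have xy : `|x - y| <= de.
  move: H; apply: contraNT; rewrite -ltNge => H.
  have r1 : 1 < `|(x - y) / de|.
    by rewrite normrM normfV (gtr0_norm de0) ltr_pdivlMr// mul1r.
  by have [-> _ _] := chi_off r1; rewrite mul0r eqxx.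
have [] := near_diag (ltW de0) xy; move: mI; set m := t * x + _.
rewrite !ler_distl => mI /andP[? ?] /andP[? ?].
by move: mI => /andP[? ?]; split; [lra|rewrite -ler_distl|lra|lra].
Qed.

Lemma chi_continuous : [/\ continuous chi, continuous chi1 & continuous chi2].
Proof.
have [d1 d2 c2 _ _] := cut; split => //.
  by move=> r; exact: is_derive1_continuous (d1 r).
by move=> r; exact: is_derive1_continuous (d2 r).
Qed.

Lemma offset_continuous (c : R) : continuous (fun z : R * R => (z.1 - z.2) / c).
Proof.
move=> z; apply: cvgM; last exact: cvg_cst.
by apply: cvgB; [exact: cvg_fst|exact: cvg_snd].
Qed.

Lemma mid_continuous : continuous (fun z : R * R => t * z.1 + (1 - t) * z.2).
Proof.
move=> z; apply: cvgD; (apply: cvgM; first exact: cvg_cst).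
  exact: cvg_fst.
exact: cvg_snd.
Qed.

Lemma diag_osc_continuous th a : sym a ->
  continuous (fun z : R * R => osc th a (t * z.1 + (1 - t) * z.2) ((z.1 - z.2) / h)).
Proof.
move=> sa.
have c1 : continuous (fun z : R * R => (t * z.1 + (1 - t) * z.2, (z.1 - z.2) / h)).
  move=> z; apply: (@cvg_pair _ _ _ (nbhs z) (nbhs (t * z.1 + (1 - t) * z.2))
    (nbhs ((z.1 - z.2) / h)) _ _ _ (fun z => t * z.1 + (1 - t) * z.2)
    (fun z => (z.1 - z.2) / h)).
    exact: (mid_continuous (x := z)).
  exact: (offset_continuous (c := h) (x := z)).
exact: (continuous_compose c1 (@osc_continuous _ al be M a th sa)).
Qed.

Lemma diag_chi_continuous (c : R -> R) : continuous c ->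
  continuous (fun z : R * R => c ((z.1 - z.2) / de)).
Proof. by move=> cc; exact: (continuous_compose (@offset_continuous de) cc). Qed.

Lemma cut0_continuous th a : sym a -> continuous (diag_coord (cut0 th a)).
Proof.
move=> sa z; have [c0 _ _] := chi_continuous.
by apply: cvgM; [exact: (diag_chi_continuous c0)|exact: diag_osc_continuous].
Qed.

Lemma cut2_continuous la si nu th a : sym a -> continuous (diag_coord (cut2 la si nu th a)).
Proof.
move=> sa z; have [c0 c1 c2] := chi_continuous.
have sx := boxsym_dx sa; have sxx := boxsym_dx sx.
have sxi := boxsym_xi sa; have sxix := boxsym_xi sx; have sxi2 := boxsym_xi sxi.
apply: cvgD; first apply: cvgD.
- apply: cvgM; last exact: diag_osc_continuous.
  by apply: cvgM; [exact: cvg_cst|exact: (diag_chi_continuous c2)].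
- apply: cvgM; first by apply: cvgM; [exact: cvg_cst|exact: (diag_chi_continuous c1)].
  by apply: cvgD; (apply: cvgM; [exact: cvg_cst|exact: diag_osc_continuous]).
- apply: cvgM; first exact: (diag_chi_continuous c0).
  apply: cvgD; first apply: cvgD.
  + by apply: cvgM; [exact: cvg_cst|exact: diag_osc_continuous].
  + by apply: cvgM; [exact: cvg_cst|exact: diag_osc_continuous].
  + by apply: cvgM; [exact: cvg_cst|exact: diag_osc_continuous].
Qed.

Lemma cut2_bounded la si nu th a : sym a -> exists K, 0 <= K /\
  forall m s r, `|cut2 la si nu th a m s r| <= K.
Proof.
move=> sa; have [_ _ _ bX _] := cut.
have X0 : 0 <= X by have [/(le_trans (normr_ge0 _))] := bX 0.
have sx := boxsym_dx sa; have sxx := boxsym_dx sx.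
have sxi := boxsym_xi sa; have sxix := boxsym_xi sx; have sxi2 := boxsym_xi sxi.
have [K1 [K10 H1]] := osc_bounded sa; have [K2 [K20 H2]] := osc_bounded sx.
have [K3 [K30 H3]] := osc_bounded sxi; have [K4 [K40 H4]] := osc_bounded sxx.
have [K5 [K50 H5]] := osc_bounded sxix; have [K6 [K60 H6]] := osc_bounded sxi2.
exists (`|nu ^+ 2| * X * K1 + `|2 * nu| * X * (`|la| * K2 + `|si| * K3)
  + X * (`|la ^+ 2| * K4 + `|2 * la * si| * K5 + `|si ^+ 2| * K6)).
split; first by rewrite !addr_ge0 ?mulr_ge0 ?addr_ge0 ?mulr_ge0.
move=> m s r; have [b0 b1 b2 _] := bX r.
apply: (le_trans (ler_normD _ _)); apply: lerD.
  apply: (le_trans (ler_normD _ _)); apply: lerD.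
    by rewrite !normrM ler_pM ?mulr_ge0// ler_wpM2l.
  rewrite normrM (normrM (2 * nu)) ler_pM ?mulr_ge0//; first by rewrite ler_wpM2l.
  by apply: (le_trans (ler_normD _ _)); apply: lerD; rewrite normrM ler_wpM2l.
rewrite normrM ler_pM//.
apply: (le_trans (ler_normD _ _)); apply: lerD; last by rewrite normrM ler_wpM2l.
by apply: (le_trans (ler_normD _ _)); apply: lerD; rewrite normrM ler_wpM2l.
Qed.

Lemma cut2_off la si nu th a m s r : 1 < `|r| -> cut2 la si nu th a m s r = 0.
Proof. by move=> /chi_off[c0 c1 c2]; rewrite /cut2 c0 c1 c2 !(mulr0, mul0r, addr0). Qed.

(** The constant blows up as h tends to 0: this serves for integrability only, never for
estimates. *)
Lemma dominated_near_diag (K : R) (k : R * R -> R) : 0 <= K -> measurable_fun [set: plane R] k ->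
  (forall z, `|k z| <= K) -> (forall z, de < `|z.1 - z.2| -> k z = 0) ->
  dominated h (K * (1 + (de / h) ^+ 2)) k.
Proof.
move=> K0 mk kK zk; split=> // z; have [H|H] := leP `|z.1 - z.2| de; last first.
  by rewrite zk// normr0 mulr_ge0 ?weight_ge0// mulr_ge0// addr_ge0// sqr_ge0.
apply: (le_trans (kK z)); rewrite -mulrA ler_peMr// /weight.
rewrite ler_pdivlMr ?weight_den_gt0// mul1r lerD2l.
rewrite -(real_normK (num_real (_ / _))) -[leRHS](real_normK (num_real _)).
rewrite ler_pXn2r ?nnegrE// !normrM.
by rewrite ler_wpM2r// (ger0_norm (ltW de0)).
Qed.

Section Solution.
Variables (V : R -> R) (E : R) (G G' : R -> R).
Hypotheses (p0 : 0 < al - de) (sol : solves h V E G G').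
Hypothesis mV : measurable_fun [set: measurableTypeR R] (half_restrict V).
Hypothesis mG : measurable_fun [set: measurableTypeR R] (half_restrict G).
Hypothesis G1 : (\int[lebesgue_measure]_x ((half_restrict G x) ^+ 2)%:E = 1)%E.

Let V_bounded : exists K, 0 <= K /\ forall x, al - de <= x <= be + de ->
  `|half_restrict V x - E| <= K.
Proof.
have cV : {within `[al - de, be + de], continuous V}.
  apply: continuous_in_subspaceT => y; rewrite inE/= in_itv/= => /andP[py _].
  by have [] := sol (lt_le_trans p0 py).
have [K [K0 HK]] := compact_bounded_real (@segment_compact _ _ _) cV.
exists (K + `|E|); split; first by rewrite addr_ge0.
move=> x /andP[px xq]; rewrite half_restrictE; last by rewrite ltW// (lt_le_trans p0).
by apply: (le_trans (ler_normB _ _)); rewrite lerD2r HK//= in_itv/= px.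
Qed.

(** What integration by parts in the second (resp. first) variable annihilates: h^2 times a
second derivative of the cut-off kernel, minus the kernel times V - E. *)
Definition defect_snd th a (z : R * R) : R :=
  h ^+ 2 * diag_coord (cut2 (1 - t) (- h^-1) (- de^-1) th a) z
  - diag_coord (cut0 th a) z * (half_restrict V z.2 - E).

Definition defect_fst th a (z : R * R) : R :=
  h ^+ 2 * diag_coord (cut2 t h^-1 de^-1 th a) z
  - diag_coord (cut0 th a) z * (half_restrict V z.1 - E).

Let defect_dominated la si nu th a (pr : R * R -> R) : sym a ->
  (pr = fst \/ pr = snd) ->
  exists K, dominated h K (fun z => h ^+ 2 * diag_coord (cut2 la si nu th a) z
  - diag_coord (cut0 th a) z * (half_restrict V (pr z) - E)).
Proof.
move=> sa prE; have [_ _ _ bX _] := cut.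
have X0 : 0 <= X by have [/(le_trans (normr_ge0 _))] := bX 0.
have [K1 [K10 H1]] := cut2_bounded la si nu th sa.
have [K2 [K20 H2]] := osc_bounded sa.
have [K3 [K30 H3]] := V_bounded.
exists ((h ^+ 2 * K1 + X * K2 * K3) * (1 + (de / h) ^+ 2)).
apply: dominated_near_diag.
- by apply: addr_ge0; apply: mulr_ge0 => //; [exact: sqr_ge0|exact: mulr_ge0].
- have mVp : measurable_fun [set: plane R] (fun z => half_restrict V (pr z)).
    by case: prE => ->; [exact: measurable_comp_fst|exact: measurable_comp_snd].
  apply: measurable_funB.
    apply: measurable_funM => //; apply: continuous_plane_measurable.
    exact: cut2_continuous.
  apply: measurable_funM; last exact: measurable_funB.
  by apply: continuous_plane_measurable; exact: cut0_continuous.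
- move=> z; apply: (le_trans (ler_normB _ _)); apply: lerD.
    rewrite normrM (ger0_norm (sqr_ge0 h)) ler_wpM2l ?sqr_ge0//; exact: H1.
  have [->|nz] := eqVneq (diag_coord (cut0 th a) z) 0.
    by rewrite mul0r normr0 !mulr_ge0.
  rewrite normrM ler_pM//.
    by rewrite /diag_coord /cut0 normrM ler_pM//; have [] := bX ((z.1 - z.2) / de).
  move: nz; rewrite (surjective_pairing z) => /(cut_loc sa)[_ _ ? ?].
  by apply: H3; case: prE => ->.
- move=> z H.
  have r1 : 1 < `|(z.1 - z.2) / de|.
    by rewrite normrM normfV (gtr0_norm de0) ltr_pdivlMr// mul1r.
  rewrite /diag_coord cut2_off// /cut0; have [-> _ _] := chi_off r1.
  by rewrite !mul0r mulr0 subr0.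
Qed.

Lemma defect_snd_dominated th a : sym a -> exists K, dominated h K (defect_snd th a).
Proof. by move=> sa; apply: (defect_dominated _ _ _ _ (pr := snd)) => //; right. Qed.

Lemma defect_fst_dominated th a : sym a -> exists K, dominated h K (defect_fst th a).
Proof. by move=> sa; apply: (defect_dominated _ _ _ _ (pr := fst)) => //; left. Qed.

(** For fixed x the inner integral over y vanishes, by [ibp_solution]. *)
Lemma quad_defect_snd th a : sym a -> quad (half_restrict G) (defect_snd th a) = 0.
Proof.
move=> sa; have [K dK] := defect_snd_dominated th sa.
rewrite (quad_iter12 mG G1 h0 dK).
rewrite (_ : (fun x => _) = cst 0); first by rewrite /Rintegral integral0.
apply/funext => x; rewrite [X in X * _](_ : _ = 0) ?mul0r//.
rewrite /defect_snd /=.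
pose dc F := fun y => diag_coord F (x, y).
have c2 : continuous (dc (cut2 (1 - t) (- h^-1) (- de^-1) th a)).
  have c := @cut2_continuous (1 - t) (- h^-1) (- de^-1) th a sa.
  exact: (@continuous_compose _ _ _ (fun y => (x, y)) _ (@pair_continuous _ x) c).
apply: (@ibp_solution _ h V E G G' (dc (cut0 th a))
  (dc (cut1 (1 - t) (- h^-1) (- de^-1) th a))
  (dc (cut2 (1 - t) (- h^-1) (- de^-1) th a)) (al - de) (be + de)) => //.
- by rewrite gt_eqF.
- move=> y H; apply/eqP; apply: contraNT H => H.
  by have [] := cut_loc sa H.
- by move=> y; rewrite /dc diag_coord_snd; under eq_fun do rewrite diag_coord_snd;
    exact: cut0_line.
- by move=> y; rewrite /dc diag_coord_snd; under eq_fun do rewrite diag_coord_snd;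
    exact: cut1_line.
Qed.

Lemma quad_defect_fst th a : sym a -> quad (half_restrict G) (defect_fst th a) = 0.
Proof.
move=> sa; have [K dK] := defect_fst_dominated th sa.
rewrite (quad_iter21 mG G1 h0 dK).
rewrite (_ : (fun x => _) = cst 0); first by rewrite /Rintegral integral0.
apply/funext => y; rewrite [X in X * _](_ : _ = 0) ?mul0r//.
rewrite /defect_fst /=.
pose dc F := fun x => diag_coord F (x, y).
have c2 : continuous (dc (cut2 t h^-1 de^-1 th a)).
  have cp : continuous (fun x : R => (x, y)).
    move=> x; apply: (@cvg_pair _ _ _ (nbhs x) (nbhs x) (nbhs y) _ _ _ id (cst y)).
      exact: cvg_id.
    exact: cvg_cst.
  have c := @cut2_continuous t h^-1 de^-1 th a sa.
  exact: (@continuous_compose _ _ _ (fun x => (x, y)) _ cp c).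
apply: (@ibp_solution _ h V E G G' (dc (cut0 th a))
  (dc (cut1 t h^-1 de^-1 th a))
  (dc (cut2 t h^-1 de^-1 th a)) (al - de) (be + de)) => //.
- by rewrite gt_eqF.
- move=> x H; apply/eqP; apply: contraNT H => H.
  by have [] := cut_loc sa H.
- by move=> x; rewrite /dc diag_coord_fst; under eq_fun do rewrite diag_coord_fst;
    exact: cut0_line.
- by move=> x; rewrite /dc diag_coord_fst; under eq_fun do rewrite diag_coord_fst;
    exact: cut1_line.
Qed.

End Solution.
End CutKernels.

(** * Quantitative propagation estimates *)
Section Estimates.
Context {R : realType}.
Variables (al be M : R).
Local Notation sym := (boxsym al be M).

Lemma widen_itv (p q e x : R) : 0 <= e -> p <= x <= q -> p - e <= x <= q + e.
Proof. by move=> e0 /andP[? ?]; apply/andP; split; lra. Qed.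

Lemma between_near (p q m e x y u : R) :
  p <= u <= q -> p <= y <= q -> `|u - m| <= e -> `|y - m| <= e ->
  Num.min y u <= x <= Num.max y u -> (p <= x <= q) /\ `|x - m| <= e.
Proof.
rewrite !ler_distl => /andP[? ?] /andP[? ?] /andP[? ?] /andP[? ?] /andP[].
by case: (leP y u) => _ ? ?; split; apply/andP; split; lra.
Qed.

Lemma normM_le (x y A B : R) : `|x| <= A -> `|y| <= B -> `|x * y| <= A * B.
Proof. by move=> xA yB; rewrite normrM ler_pM. Qed.

Lemma normD_le (x y A B : R) : `|x| <= A -> `|y| <= B -> `|x + y| <= A + B.
Proof. by move=> xA yB; apply: (le_trans (ler_normD _ _)); exact: lerD. Qed.

(** Decay of order four is spent here: two powers of s make the weight integrable, and up to
two more absorb the factors s that the increments of V produce. *)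
Lemma osc_weight a : sym a -> exists K, 0 <= K /\ forall th m s,
  (1 + `|s| + `|s| ^+ 2) * `|osc th a m s| <= K * (1 + s ^+ 2)^-1.
Proof.
move=> sa.
have [K0 [K00 H0]] := osc_decay 0 sa; have [K1 [K10 H1]] := osc_decay 1 sa.
have [K2 [K20 H2]] := osc_decay 2 sa; have [K3 [K30 H3]] := osc_decay 3 sa.
have [K4 [K40 H4]] := osc_decay 4 sa.
exists (K0 + K1 + (K2 + K2) + K3 + K4); split; first by rewrite !addr_ge0.
move=> th m s; rewrite ler_pdivlMr; last by rewrite ltr_pwDl// sqr_ge0.
have := H0 th m s; have := H1 th m s; have := H2 th m s; have := H3 th m s.
have := H4 th m s; rewrite -(real_normK (num_real s)).
set S := `|s|; set o := `|osc th a m s| => h4 h3 h2 h1 h0'.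
rewrite [leLHS](_ : _ = S ^+ 0 * o + S ^+ 1 * o + (S ^+ 2 * o + S ^+ 2 * o) + S ^+ 3 * o
  + S ^+ 4 * o); last by ring.
by rewrite !lerD.
Qed.

Lemma osc_weight3 a : sym a -> exists K, 0 <= K /\ forall th m s,
  [/\ `|osc th a m s| <= K * (1 + s ^+ 2)^-1,
      `|s| * `|osc th a m s| <= K * (1 + s ^+ 2)^-1 &
      `|s| ^+ 2 * `|osc th a m s| <= K * (1 + s ^+ 2)^-1].
Proof.
move=> sa; have [K [K0 HK]] := osc_weight sa; exists K; split=> // th m s.
have := HK th m s; rewrite !mulrDl mul1r; set o := `|osc _ _ _ _| => H.
have o0 : 0 <= o by exact: normr_ge0.
have o1 : 0 <= `|s| * o by rewrite mulr_ge0.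
have o2 : 0 <= `|s| ^+ 2 * o by rewrite mulr_ge0// sqr_ge0.
by split; lra.
Qed.

Lemma dominatedD (h K K' : R) k k' : dominated h K k -> dominated h K' k' ->
  dominated h (K + K') (fun z => k z + k' z).
Proof.
move=> [mk bk] [mk' bk']; split; first exact: measurable_funD.
by move=> z; rewrite mulrDl; exact: normD_le.
Qed.

Lemma dominatedZ (h K c : R) k : dominated h K k ->
  dominated h (`|c| * K) (fun z => c * k z).
Proof.
move=> [mk bk]; split; first exact: measurable_funM.
by move=> z; rewrite -mulrA; exact: normM_le.
Qed.

Variables (X : R) (chi chi1 chi2 : R -> R).
Hypothesis cut : is_cutoff X chi chi1 chi2.
Variables (de t : R).
Hypotheses (de0 : 0 < de) (t01 : 0 <= t <= 1) (p0 : 0 < al - de).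

(** The kernel of mu_h, up to the factor 1 / (2 pi h), before any cut-off. *)
Definition diag_osc (h : R) (a : R * R -> R) (z : R * R) : R :=
  osc 0 a (t * z.1 + (1 - t) * z.2) ((z.1 - z.2) / h).

Lemma diag_osc_dominated a : sym a -> exists K, 0 <= K /\
  forall h, 0 < h -> dominated h K (diag_osc h a).
Proof.
move=> sa; have [K [K0 HK]] := osc_weight3 sa; exists K; split => // h h0; split.
  by apply: continuous_plane_measurable; exact: (@diag_osc_continuous _ al be M t h 0 a sa).
by move=> z; have [H _ _] := HK 0 (t * z.1 + (1 - t) * z.2) ((z.1 - z.2) / h); exact: H.
Qed.

Let X0 : 0 <= X.
Proof. by have [_ _ _ /(_ 0)[/(le_trans (normr_ge0 _))]] := cut. Qed.

Let s_of (h : R) (z : R * R) := (z.1 - z.2) / h.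
Let m_of (z : R * R) := t * z.1 + (1 - t) * z.2.

Let r_s h z : h != 0 -> (z.1 - z.2) / de = de^-1 * h * s_of h z.
Proof. by move=> h0; rewrite /s_of; field; rewrite h0 gt_eqF. Qed.

Let de1 : `|de^-1| <= de^-1.
Proof. by rewrite ger0_norm// invr_ge0 ltW. Qed.

Let t1 : `|1 - t| <= 1.
Proof. by move: t01 => /andP[? ?]; rewrite ler_norml; apply/andP; split; lra. Qed.

Let t2 : `|2 * t - 1| <= 1.
Proof. by move: t01 => /andP[? ?]; rewrite ler_norml; apply/andP; split; lra. Qed.

(** Removing the cut-off costs O(h): chi(0) = 1 and r = h s / de. *)
Let uncut (h r s o K w : R) : 0 < h -> r = de^-1 * h * s -> `|s| * `|o| <= K * w ->
  `|(1 - chi r) * o| <= h * (X * de^-1 * K) * w.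
Proof.
move=> h0 rE so; have [_ _ _ /(_ r)[_ _ _ br] _] := cut.
rewrite normrM; apply: (le_trans (ler_wpM2r (normr_ge0 _) br)).
rewrite rE !normrM (gtr0_norm h0) (ger0_norm (ltW _)) ?invr_gt0//.
rewrite [leLHS](_ : _ = X * de^-1 * h * (`|s| * `|o|)); last by ring.
rewrite [leRHS](_ : _ = X * de^-1 * h * (K * w)); last by ring.
by rewrite ler_wpM2l// !mulr_ge0// ?invr_ge0 ltW.
Qed.

Section Support.
Variables (V0 : R -> R) (E0 L : R) (a : R * R -> R).
Hypothesis sa : sym a.
Hypothesis sc : sym (fun z => (V0 z.1 - E0) * a z).
Hypothesis L0 : 0 <= L.
Hypothesis V0L : forall x y, al - de <= x <= be + de -> al - de <= y <= be + de ->
  `|V0 x - V0 y| <= L * `|x - y|.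

(** Adding the defect, whose form vanishes, to the kernel of (xi^2 + V0 - E0) a leaves a
remainder N bounded pointwise by (h + eps) times the weight: two derivatives in s shift the
phase by pi, so that the second derivative in the defect cancels the kernel of xi^2 a, and its
potential term cancels that of (V0 - E0) a. *)
Lemma energy_estimate : exists K, 0 <= K /\
  forall (h : R) V E G G' (eps : R), 0 < h <= 1 -> 0 <= eps -> solves h V E G G' ->
  measurable_fun [set: measurableTypeR R] (half_restrict V) ->
  measurable_fun [set: measurableTypeR R] (half_restrict G) ->
  (\int[lebesgue_measure]_x ((half_restrict G x) ^+ 2)%:E = 1)%E ->
  (forall x, al - de <= x <= be + de -> `|(V0 x - E0) - (V x - E)| <= eps) ->
  `|quad (half_restrict G)
     (diag_osc h (fun z => z.2 * (z.2 * a z) + (V0 z.1 - E0) * a z))|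
     <= K * (h + eps) * (h * pi).
Proof.
have sx := boxsym_dx sa; have sxx := boxsym_dx sx.
have sxi := boxsym_xi sa; have sxix := boxsym_xi sx; have sxi2 := boxsym_xi sxi.
pose b := fun z : R * R => z.2 * (z.2 * a z) + (V0 z.1 - E0) * a z.
have sb : sym b := boxsymD sxi2 sc.
have [Ka [Ka0 Ha]] := osc_weight3 sa; have [Kx [Kx0 Hx]] := osc_weight3 sx.
have [Kxx [Kxx0 Hxx]] := osc_weight3 sxx; have [Kd [Kd0 Hd]] := osc_weight3 sxi.
have [Kc [Kc0 Hc]] := osc_weight3 sxix; have [Kb [Kb0 Hb]] := osc_weight3 sb.
pose KR := 1 * de^-1 ^+ 2 * X * Ka + 2 * de^-1 * X * (1 * 1 * Kx + Kd)
  + X * (1 * 1 * Kxx + 2 * 1 * Kc).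
pose K := X * de^-1 * Kb + KR + X * Ka + X * L * Ka.
have dV0 : 0 <= de^-1 by rewrite invr_ge0 ltW.
have KR0 : 0 <= KR by rewrite /KR !addr_ge0// ?mulr_ge0// ?addr_ge0// ?mulr_ge0// ?sqr_ge0.
exists K; split.
  by rewrite /K; do ?[apply: addr_ge0|apply: mulr_ge0].
move=> h V E G G' eps /andP[h0 h1] eps0 sol mV mG G1 Veps.
have hn0 : h != 0 by rewrite gt_eqF.
pose d := defect_snd chi chi1 chi2 de t h V E 0 a.
have [Kd' dd] := defect_snd_dominated cut de0 t01 p0 sol mV 0 sa.
have d0 : quad (half_restrict G) d = 0.
  exact: (quad_defect_snd cut de0 t01 h0 p0 sol mV mG G1 0 sa).
pose N z := diag_osc h b z + d z.
have mN : measurable_fun [set: plane R] N.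
  apply: measurable_funD; last exact: dd.1.
  by apply: continuous_plane_measurable; exact: (@diag_osc_continuous _ al be M t h 0 b sb).
have bN z : `|N z| <= K * (h + eps) * weight h z.
  pose m := m_of z; pose s := s_of h z; pose r := (z.1 - z.2) / de.
  have rE : r = de^-1 * h * s by exact: r_s.
  pose w := (1 + s ^+ 2)^-1; rewrite -[weight h z]/w.
  have w0 : 0 <= w by exact: (weight_ge0 h z).
  have [cb0 cb1 cb2 _] : [/\ `|chi r| <= X, `|chi1 r| <= X, `|chi2 r| <= X &
        `|1 - chi r| <= X * `|r|] by have [_ _ _ + _] := cut; apply.
  pose Rem := h * de^-1 ^+ 2 * chi2 r * osc 0 a m s
    + - (2 * de^-1 * chi1 r * (h * (1 - t) * osc 0 (dx a) m s
       - osc (0 + pi / 2) (fun z => z.2 * a z) m s))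
    + chi r * (h * (1 - t) ^+ 2 * osc 0 (dx (dx a)) m s
       - 2 * (1 - t) * osc (0 + pi / 2) (fun z => z.2 * dx a z) m s).
  have NE : N z = (1 - chi r) * osc 0 b m s + h * Rem
    + chi r * osc 0 a m s * ((V0 m - E0) - (half_restrict V z.2 - E)).
    rewrite /N /d /defect_snd /diag_osc /diag_coord /cut2 /cut0 -/m -/s -/r.
    rewrite -[t * z.1 + (1 - t) * z.2]/m -[(z.1 - z.2) / h]/s.
    rewrite (oscDpi 0 m s sxi2).
    have -> : osc 0 b m s = osc 0 (fun z => z.2 * (z.2 * a z)) m s
       + (V0 m - E0) * osc 0 a m s.
      by rewrite (oscD 0 m s sxi2 sc) (osc_mulV (fun x => V0 x - E0) 0 m s sa).
    rewrite /Rem; do ![move: (osc _ _ _ _) => ?]; move: (chi _) (chi1 _) (chi2 _) => ? ? ?.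
    move: (half_restrict V _) (V0 _) => ? ?; field.
    by rewrite gt_eqF// hn0.
  have bRem : `|Rem| <= KR * w.
    have -> : KR * w = 1 * de^-1 ^+ 2 * X * (Ka * w)
        + 2 * de^-1 * X * (1 * 1 * (Kx * w) + Kd * w)
        + X * (1 * 1 * (Kxx * w) + 2 * 1 * (Kc * w)) by rewrite /KR; ring.
    have hle : `|h| <= 1 by rewrite gtr0_norm.
    have two : `|2 : R| <= 2 by rewrite ger0_norm.
    have [ka _ _] := Ha 0 m s; have [kx _ _] := Hx 0 m s; have [kxx _ _] := Hxx 0 m s.
    have [kd _ _] := Hd (0 + pi / 2) m s; have [kc _ _] := Hc (0 + pi / 2) m s.
    have t1' : `|(1 - t) ^+ 2| <= 1 by rewrite normrX exprn_ile1.
    have de2 : `|de^-1 ^+ 2| <= de^-1 ^+ 2 by rewrite ger0_norm// sqr_ge0.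
    apply: normD_le; first apply: normD_le.
    - by do !apply: normM_le.
    - rewrite normrN; apply: normM_le; first by do !apply: normM_le.
      by apply: normD_le; [do !apply: normM_le|rewrite normrN].
    - apply: normM_le => //; apply: normD_le; first by do !apply: normM_le.
      by rewrite normrN; do !apply: normM_le.
  have [ka0 ka1 _] := Ha 0 m s; have [_ kb1 _] := Hb 0 m s.
  have bpot : `|chi r * osc 0 a m s * ((V0 m - E0) - (half_restrict V z.2 - E))|
      <= (X * Ka * eps + X * L * Ka * h) * w.
    have [z0|nz] := eqVneq (chi r * osc 0 a m s) 0.
      by rewrite z0 mul0r normr0 !mulr_ge0// addr_ge0// !mulr_ge0// ltW.
    have [mI xy /= xI yI] := @cut_loc _ _ _ _ _ _ _ _ cut de t h de0 t01 0 a z.1 z.2 sa nz.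
    have [_ ym] := near_diag t01 (normr_ge0 _) (lexx `|z.1 - z.2|).
    have xyE : `|z.1 - z.2| = h * `|s|.
      by rewrite /s /s_of normrM normfV (gtr0_norm h0) mulrC divfK.
    have mI' : al - de <= m <= be + de.
      exact: widen_itv (ltW de0) mI.
    have bV : `|(V0 m - E0) - (half_restrict V z.2 - E)| <= L * (h * `|s|) + eps.
      rewrite half_restrictE; last by move: yI => /andP[/(le_trans (ltW p0))].
      rewrite (_ : _ - _ = (V0 m - V0 z.2) + ((V0 z.2 - E0) - (V z.2 - E))); last by ring.
      apply: normD_le; last exact: Veps.
      by apply: (le_trans (V0L mI' yI)); rewrite ler_wpM2l// -xyE distrC.
    apply: (le_trans (normM_le (normM_le cb0 (lexx _)) bV)).
    rewrite [leLHS](_ : _ = X * (L * h * (`|s| * `|osc 0 a m s|) + eps * `|osc 0 a m s|));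
      last by ring.
    rewrite [leRHS](_ : _ = X * (L * h * (Ka * w) + eps * (Ka * w))); last by ring.
    by rewrite ler_wpM2l// lerD// ler_wpM2l// mulr_ge0// ltW.
  rewrite NE (_ : K * (h + eps) * w = (h * (X * de^-1 * Kb) * w + h * (KR * w)
     + (X * Ka * eps + X * L * Ka * h) * w)
     + (X * de^-1 * Kb * eps + KR * eps + X * L * Ka * eps + X * Ka * h) * w); last first.
    by rewrite /K; ring.
  apply: ler_wpDr.
    have hge0 : 0 <= h by exact: ltW.
    by do ?[apply: addr_ge0|apply: mulr_ge0].
  apply: normD_le => //; apply: normD_le; first exact: (uncut h0 rE kb1).
  by apply: normM_le => //; rewrite gtr0_norm.
have dN : dominated h (K * (h + eps)) N by [].
rewrite (_ : diag_osc h _ = fun z => N z - d z); last first.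
  by apply/funext => z; rewrite /N addrK.
rewrite (quadB mG G1 h0 dN dd) d0 subr0.
exact: (quad_le mG G1 h0 dN).
Qed.
End Support.

Section Flow.
Variables (dV : R -> R) (L : R) (a : R * R -> R).
Hypothesis sa : sym a.
Hypothesis sc : sym (fun z => dV z.1 * dxi a z).
Hypothesis L0 : 0 <= L.
Hypothesis dVL : forall x y, al - de <= x <= be + de -> al - de <= y <= be + de ->
  `|dV x - dV y| <= L * `|x - y|.

(** In the difference of the two defects the terms in xi^2 a cancel and the mixed derivatives
remain; they carry a factor 1 / h, which the division of the defects by h turns into a term
of order one. The phase - pi / 2 is chosen so that the quarter period brought by one
derivative in s leads back to the cosine transform. *)
Lemma flow_estimate : exists K, 0 <= K /\
  forall (h : R) V V' E G G' (eps : R), 0 < h <= 1 -> 0 <= eps -> solves h V E G G' ->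
  measurable_fun [set: measurableTypeR R] (half_restrict V) ->
  measurable_fun [set: measurableTypeR R] (half_restrict G) ->
  (\int[lebesgue_measure]_x ((half_restrict G x) ^+ 2)%:E = 1)%E ->
  (forall x : R, al - de <= x <= be + de ->
     is_derive x 1 V (V' x) /\ `|V' x - dV x| <= eps) ->
  `|quad (half_restrict G)
     (diag_osc h (fun z => 2 * (z.2 * dx a z) + -1 * (dV z.1 * dxi a z)))|
     <= K * (h + eps) * (h * pi).
Proof.
have sx := boxsym_dx sa; have sxx := boxsym_dx sx; have sxi := boxsym_dxi sa.
have sxix := boxsym_xi sx; have s1 := boxsymZ 2 sxix; have s2 := boxsymZ (-1) sc.
pose b := fun z : R * R => 2 * (z.2 * dx a z) + -1 * (dV z.1 * dxi a z).
have sb : sym b := boxsymD s1 s2.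
have [Ka [Ka0 Ha]] := osc_weight3 sa; have [Kx [Kx0 Hx]] := osc_weight3 sx.
have [Kxx [Kxx0 Hxx]] := osc_weight3 sxx.
have [Kb [Kb0 Hb]] := osc_weight3 sb.
pose KR := 2 * de^-1 * X * Kx + X * (1 * Kxx).
pose K := X * de^-1 * Kb + KR + X * Ka + X * L * Ka.
have dV0 : 0 <= de^-1 by rewrite invr_ge0 ltW.
have KR0 : 0 <= KR by rewrite /KR; do ?[apply: addr_ge0|apply: mulr_ge0].
exists K; split; first by rewrite /K; do ?[apply: addr_ge0|apply: mulr_ge0].
move=> h V V' E G G' eps /andP[h0 h1] eps0 sol mV mG G1 Veps.
have hn0 : h != 0 by rewrite gt_eqF.
pose d1 := defect_fst chi chi1 chi2 de t h V E (- (pi / 2)) a.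
pose d2 := defect_snd chi chi1 chi2 de t h V E (- (pi / 2)) a.
have [Kd1 dd1] := defect_fst_dominated cut de0 t01 p0 sol mV (- (pi / 2)) sa.
have [Kd2 dd2] := defect_snd_dominated cut de0 t01 p0 sol mV (- (pi / 2)) sa.
have q1 : quad (half_restrict G) d1 = 0.
  exact: (quad_defect_fst cut de0 t01 h0 p0 sol mV mG G1 _ sa).
have q2 : quad (half_restrict G) d2 = 0.
  exact: (quad_defect_snd cut de0 t01 h0 p0 sol mV mG G1 _ sa).
pose d z := h^-1 * (d1 z - d2 z).
have ddB : dominated h (Kd1 + `|-1| * Kd2) (fun z => d1 z - d2 z).
  rewrite (_ : (fun z => _) = fun z => d1 z + -1 * d2 z).
    by apply: dominatedD => //; exact: dominatedZ.
  by apply/funext => z; rewrite mulN1r.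
have dd := dominatedZ h^-1 ddB.
have d0 : quad (half_restrict G) d = 0.
  rewrite /d /quad.
  transitivity (h^-1 * quad (half_restrict G) (fun z => d1 z - d2 z)).
    rewrite /quad -RintegralZl//; last exact: (quad_integrable mG G1 h0 ddB).
    by apply: eq_Rintegral => z _; rewrite -mulrA.
  by rewrite (quadB mG G1 h0 dd1 dd2) q1 q2 subrr mulr0.
pose N z := diag_osc h b z - d z.
have mN : measurable_fun [set: plane R] N.
  apply: measurable_funB; last exact: dd.1.
  by apply: continuous_plane_measurable; exact: (@diag_osc_continuous _ al be M t h 0 b sb).
have bN z : `|N z| <= K * (h + eps) * weight h z.
  pose m := m_of z; pose s := s_of h z; pose r := (z.1 - z.2) / de.
  have rE : r = de^-1 * h * s by exact: r_s.
  pose w := (1 + s ^+ 2)^-1; rewrite -[weight h z]/w.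
  have w0 : 0 <= w by exact: (weight_ge0 h z).
  have [cb0 cb1 cb2 _] : [/\ `|chi r| <= X, `|chi1 r| <= X, `|chi2 r| <= X &
        `|1 - chi r| <= X * `|r|] by have [_ _ _ + _] := cut; apply.
  pose A := osc (- (pi / 2)) a m s.
  pose Rem := 2 * de^-1 * chi1 r * osc (- (pi / 2)) (dx a) m s
    + chi r * ((2 * t - 1) * osc (- (pi / 2)) (dx (dx a)) m s).
  have NE : N z = (1 - chi r) * osc 0 b m s - h * Rem
    + chi r * A * ((half_restrict V z.1 - half_restrict V z.2) / h - s * dV m).
    rewrite /N /d /d1 /d2 /defect_fst /defect_snd /diag_osc /diag_coord /cut2 /cut0.
    rewrite -[t * z.1 + (1 - t) * z.2]/m -[(z.1 - z.2) / h]/s -[(z.1 - z.2) / de]/r.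
    have -> : osc 0 b m s = 2 * osc 0 (fun z => z.2 * dx a z) m s - s * dV m * A.
      rewrite (oscD 0 m s s1 s2) (osc_mulV (fun=> 2) 0 m s sxix).
      rewrite (osc_mulV (fun=> -1) 0 m s sc) (osc_mulV dV 0 m s sxi).
      rewrite (osc_dxi 0 m s sa) (_ : 0 + pi / 2 = - (pi / 2) + pi :> R); last by field.
      by rewrite (oscDpi _ m s sa) -/A; ring.
    rewrite addNr -/A /Rem.
    do ![move: (osc _ _ _ _) => ?]; move: A (chi _) (chi1 _) (chi2 _) => ? ? ? ?.
    move: (half_restrict V _) (half_restrict V _) (dV _) => ? ? ?; field.
    by rewrite ?hn0 ?(gt_eqF de0) ?(gt_eqF h0).
  have bRem : `|Rem| <= KR * w.
    have -> : KR * w = 2 * de^-1 * X * (Kx * w) + X * (1 * (Kxx * w)) by rewrite /KR; ring.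
    have two : `|2 : R| <= 2 by rewrite ger0_norm.
    have [kx _ _] := Hx (- (pi / 2)) m s; have [kxx _ _] := Hxx (- (pi / 2)) m s.
    by apply: normD_le; do !apply: normM_le.
  have [ka0 ka1 ka2] := Ha (- (pi / 2)) m s; have [_ kb1 _] := Hb 0 m s.
  have bpot : `|chi r * A * ((half_restrict V z.1 - half_restrict V z.2) / h - s * dV m)|
      <= (X * Ka * eps + X * L * Ka * h) * w.
    have [z0|nz] := eqVneq (chi r * A) 0.
      by rewrite z0 mul0r normr0 !mulr_ge0// addr_ge0// !mulr_ge0// ltW.
    have [mI xy /= xI yI] :=
      @cut_loc _ _ _ _ _ _ _ _ cut de t h de0 t01 (- (pi / 2)) a z.1 z.2 sa nz.
    have [xm ym] := near_diag t01 (normr_ge0 _) (lexx `|z.1 - z.2|).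
    have xyE : `|z.1 - z.2| = h * `|s|.
      by rewrite /s /s_of normrM normfV (gtr0_norm h0) mulrC divfK.
    have mI' : al - de <= m <= be + de.
      exact: widen_itv (ltW de0) mI.
    have pos x : al - de <= x <= be + de -> 0 <= x.
      by move=> /andP[/(le_trans (ltW p0))].
    have bV : `|(half_restrict V z.1 - half_restrict V z.2) / h - s * dV m|
        <= (eps + L * (h * `|s|)) * `|s|.
      rewrite !half_restrictE; [|exact: pos..].
      rewrite (_ : _ - _ = h^-1 * ((V z.1 - dV m * z.1) - (V z.2 - dV m * z.2))); last first.
        by rewrite /s /s_of; field.
      rewrite normrM normfV (gtr0_norm h0) ler_pdivrMl//.
      rewrite [leRHS](_ : _ = (eps + L * (h * `|s|)) * `|z.1 - z.2|); last by rewrite xyE; ring.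
      have betw x : Num.min z.2 z.1 <= x <= Num.max z.2 z.1 ->
          (al - de <= x <= be + de) /\ `|x - m| <= h * `|s|.
        move: xm ym; rewrite xyE -[t * _ + _]/m; move=> xm ym; exact: between_near xI yI xm ym.
      apply: (@mean_value_le _ (fun x => V x - dV m * x) (fun x => V' x - dV m)).
        move=> x /betw[xI' _]; have [dVx _] := Veps x xI'.
        apply: (is_derive1_eq (is_derive1D dVx (is_derive1N (is_derive1M
          (is_derive_cst (dV m) x 1) (is_derive_id x 1))))).
        by rewrite mul0r add0r mulr1.
      move=> x /betw[xI' xm']; have [_ bx] := Veps x xI'.
      rewrite (_ : _ - _ = (V' x - dV x) + (dV x - dV m)); last by ring.
      apply: normD_le => //; apply: (le_trans (dVL xI' mI')).
      by rewrite ler_wpM2l.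
    apply: (le_trans (normM_le (normM_le cb0 (lexx _)) bV)).
    rewrite [leLHS](_ : _ = X * (eps * (`|s| * `|A|) + L * h * (`|s| ^+ 2 * `|A|)));
      last by ring.
    rewrite [leRHS](_ : _ = X * (eps * (Ka * w) + L * h * (Ka * w))); last by ring.
    by rewrite ler_wpM2l// lerD// ler_wpM2l// mulr_ge0// ltW.
  rewrite NE (_ : K * (h + eps) * w = (h * (X * de^-1 * Kb) * w + h * (KR * w)
     + (X * Ka * eps + X * L * Ka * h) * w)
     + (X * de^-1 * Kb * eps + KR * eps + X * L * Ka * eps + X * Ka * h) * w); last first.
    by rewrite /K; ring.
  apply: ler_wpDr.
    have hge0 : 0 <= h by exact: ltW.
    by do ?[apply: addr_ge0|apply: mulr_ge0].
  apply: normD_le => //; apply: normD_le; first exact: (uncut h0 rE kb1).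
  by rewrite normrN; apply: normM_le => //; rewrite gtr0_norm.
have dN : dominated h (K * (h + eps)) N by [].
have [Kb' [_ /(_ h h0) db]] := diag_osc_dominated sb.
have NE : quad (half_restrict G) N = quad (half_restrict G) (diag_osc h b).
  by rewrite (quadB mG G1 h0 db dd) d0 subr0.
rewrite -[X in `|X|]/(quad (half_restrict G) (diag_osc h b)) -NE.
exact: (quad_le mG G1 h0 dN).
Qed.
End Flow.
End Estimates.

(** * Potentials *)
Section Potentials.
Context {R : realType}.
Implicit Types (f : R -> R) (A : set R).

(** Derivatives relative to [0, +oo[ and to [0, d] are ordinary derivatives at points of
]0, d[, where all the symbols live. *)
Lemma within_dnbhs_interior A (x : R) : nbhs x A -> within A x^' = x^'.
Proof.
move=> nA; apply/seteqP; split => P; rewrite /within /=.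
  move=> H; have nA' : x^' A by exact: nbhs_dnbhs.
  by apply: filterS2 H nA' => y HP Ay; apply: HP.
by move=> H; apply: filterS H => y Py _.
Qed.

Lemma derivable_within_is_derive A f (x : R) : nbhs x A -> derivable_within A f x ->
  is_derive x 1 f (deriv_within A f x).
Proof.
move=> nA; rewrite /derivable_within /deriv_within (within_dnbhs_interior nA) => cf.
set L := lim _ in cf *.
apply/is_derive1_caratheodory.
exists (fun z => if z == x then L else (f z - f x) / (z - x)); split.
- move=> z; case: eqP => [->|/eqP]; first by rewrite !subrr mulr0.
  by rewrite -subr_eq0 => /divfK ->.
- apply/continuous_withinNx; rewrite eqxx.
  apply: cvg_trans cf; apply: near_eq_cvg.
  near=> z; rewrite ifN//; near: z; exact: nbhs_dnbhs_neq.
- by rewrite eqxx.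
Unshelve. all: by end_near. Qed.

Lemma smooth_on_Dk A O f k n : open O -> O `<=` A -> smooth_on A f ->
  Dk k O (dern_within A n f).
Proof.
move=> oO OA sf; elim: k n => [|k IH] n.
  split=> // x Ox; have nA : nbhs x A by apply: filterS OA _; exact: open_nbhs_nbhs.
  by have [] := derivable_within_is_derive nA (sf n x (OA x Ox)).
apply: (@Dk_intro _ k O (dern_within A n f) (dern_within A n.+1 f)) => //.
move=> x Ox; have nA : nbhs x A by apply: filterS OA _; exact: open_nbhs_nbhs.
exact: (derivable_within_is_derive nA (sf n x (OA x Ox))).
Qed.

(** Convergence for the jets, read on the k-th component. *)
Lemma Cinfty_cvg (d : R) (W : nat -> R -> R) (W0 : R -> R) :
  (W : nat -> Cinfty d) @ \oo --> (W0 : Cinfty d) ->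
  forall k (eps : R), 0 < eps -> \forall n \near \oo, forall x, 0 <= x <= d ->
    `|dern_within `[0, d] k (W n) x - dern_within `[0, d] k W0 x| < eps.
Proof.
move=> Wc k eps e0.
have h1 : (fun n => jet d (W n)) @ \oo --> jet d W0.
  exact: (cvg_comp _ _ Wc (@initial_continuous _ _ (jet d) W0)).
have h2 := cvg_comp _ _ h1
  (@proj_continuous nat (fun=> {uniform` `[0, d] -> R}) k (jet d W0)).
have H : nbhs (@proj nat (fun=> {uniform` `[0, d] -> R}) k (jet d W0))
    [set g : {uniform` `[0, d] -> R} | forall x : R, `[0, d]%classic x ->
      `|g x - dern_within `[0, d] k W0 x| < eps].
  apply/uniform_nbhs; exists [set uv : R * R | ball uv.1 eps uv.2]; split.
    exact: (entourage_ball _ (PosNum e0)).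
  by move=> g /= gE x Ax; rewrite distrC; exact: gE.
have [N _ HN] := h2 _ H; by exists N.
Qed.


Lemma nbhs_itv_oo (p q x : R) (A : set R) : p < x < q -> `]p, q[ `<=` A -> nbhs x A.
Proof.
move=> xpq sA; apply: filterS sA _; apply: open_nbhs_nbhs; split; first exact: interval_open.
by rewrite /= in_itv.
Qed.

Section Family.
Variables (gamma d : R).

Let pos_sub : `]0, d[ `<=` (`[0, d]%classic : set R).
Proof. by move=> x /=; rewrite !in_itv/= => /andP[/ltW-> /ltW->]. Qed.

Let half_sub : `]0, d[ `<=` (`[0, +oo[%classic : set R).
Proof. by move=> x /=; rewrite !in_itv/= => /andP[/ltW->]. Qed.

Lemma Dk_potential W0 k : smooth_on `[0, d] W0 ->
  Dk k `]0, d[ (fun x => x `^ gamma * W0 x).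
Proof.
move=> sW; have oI : open (`]0, d[%classic : set R) by exact: interval_open.
apply: (@DkM _ k _ (fun x => x `^ gamma)); [exact: oI|exact: Dk_powR|].
exact: (@smooth_on_Dk `[0, d]%classic `]0, d[%classic W0 k 0 oI pos_sub sW).
Qed.

(** The derivative of W is expressed within [0, d], as it is in the jets, although W is only
known to be smooth relative to [0, +oo[. *)
Lemma is_derive_potential V W (x : R) : smooth_on `[0, +oo[ W ->
  (forall x, 0 < x -> V x = x `^ gamma * W x) -> 0 < x < d ->
  is_derive x 1 V (gamma * x `^ (gamma - 1) * W x
    + x `^ gamma * dern_within `[0, d] 1 W x).
Proof.
move=> sW VE xd; have /andP[x0 _] := xd.
have n1 : nbhs x (`[0, +oo[%classic : set R) by exact: nbhs_itv_oo xd half_sub.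
have n2 : nbhs x (`[0, d]%classic : set R) by exact: nbhs_itv_oo xd pos_sub.
have dW : is_derive x 1 W (dern_within `[0, d] 1 W x).
  have := derivable_within_is_derive n1 (sW 0%N x _).
  rewrite /dern_within /= /deriv_within (within_dnbhs_interior n1) (within_dnbhs_interior n2).
  by apply; rewrite in_itv/= ltW.
apply: (@near_eq_is_derive _ _ _ (fun x => x `^ gamma * W x)); last first.
  exact: is_derive1M (is_derive1_powR gamma x0) dW.
by near=> y; rewrite VE//; near: y; exact: lt_nbhsr.
Unshelve. all: by end_near. Qed.

(** The components of order 0 and 1 of the jets control V and V'; on [p, q] the powers of x
are bounded, which turns convergence of W into convergence of x^gamma W. *)
Lemma potential_cvg (V W : nat -> R -> R) W0 (p q : R) : 0 < p -> q < d ->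
  (forall n, smooth_on `[0, +oo[ (W n)) -> smooth_on `[0, d] W0 ->
  (forall n x, 0 < x -> V n x = x `^ gamma * W n x) ->
  (W : nat -> Cinfty d) @ \oo --> (W0 : Cinfty d) ->
  let V0 := fun x => x `^ gamma * W0 x in
  forall eps : R, 0 < eps -> \forall n \near \oo, forall x : R, p <= x <= q ->
    [/\ is_derive x 1 (V n) (derive1 (V n) x), `|V n x - V0 x| <= eps &
        `|derive1 (V n) x - derive1 V0 x| <= eps].
Proof.
move=> p0 qd sW sW0 VE cW V0 eps eps0.
have cpow r : {within `[p, q], continuous (fun x : R => x `^ r)}.
  apply: continuous_in_subspaceT => x; rewrite inE/= in_itv/= => /andP[px _].
  exact: is_derive1_continuous (is_derive1_powR r (lt_le_trans p0 px)).
have [C1 [C10 H1]] := compact_bounded_real (@segment_compact _ p q) (cpow gamma).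
have [C2 [C20 H2]] := compact_bounded_real (@segment_compact _ p q) (cpow (gamma - 1)).
pose C := C1 + `|gamma| * C2 + 1.
have C0 : 0 < C by rewrite ltr_wpDl// addr_ge0// mulr_ge0.
have e0 : 0 < eps / C by rewrite divr_gt0.
have sV0 : smooth_on `[0, d] W0 := sW0.
have [N0 _ HN0] := Cinfty_cvg cW 0 e0; have [N1 _ HN1] := Cinfty_cvg cW 1 e0.
exists (maxn N0 N1) => // n; rewrite /= geq_max => /andP[n0 n1] x xpq.
have /andP[px xq] := xpq.
have x0 : 0 < x by exact: lt_le_trans p0 px.
have xd : x < d by exact: le_lt_trans xq qd.
have xI : 0 < x < d by rewrite x0.
have xI' : 0 <= x <= d by rewrite !ltW.
have dV := is_derive_potential (sW n) (VE n) xI.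
have dV0 : is_derive x 1 V0 (gamma * x `^ (gamma - 1) * W0 x
    + x `^ gamma * dern_within `[0, d] 1 W0 x).
  apply: is_derive1M (is_derive1_powR gamma x0) _.
  apply: (derivable_within_is_derive (nbhs_itv_oo xI pos_sub)).
  by apply: (sW0 0%N); rewrite /= in_itv.
have b0 := ltW (HN0 n n0 x xI'); have b1 := ltW (HN1 n n1 x xI').
have p1 : `|x `^ gamma| <= C1 by apply: H1; rewrite /= in_itv.
have p2 : `|x `^ (gamma - 1)| <= C2 by apply: H2; rewrite /= in_itv.
have CE : C * (eps / C) = eps by rewrite mulrC divfK// gt_eqF.
have ec0 : 0 <= eps / C by exact: ltW.
split.
- by rewrite (is_derive1_val dV).
- rewrite VE// /V0 -mulrBr; apply: (le_trans (normM_le p1 b0)).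
  by rewrite -[leRHS]CE ler_wpM2r// /C -addrA lerDl addr_ge0// mulr_ge0.
- rewrite (is_derive1_val dV) (is_derive1_val dV0).
  rewrite (_ : _ - _ = gamma * x `^ (gamma - 1) * (W n x - W0 x)
    + x `^ gamma * (dern_within `[0, d] 1 (W n) x - dern_within `[0, d] 1 W0 x));
    last by ring.
  apply: (le_trans (normD_le (normM_le (normM_le (lexx _) p2) b0) (normM_le p1 b1))).
  by rewrite -mulrDl -[leRHS]CE ler_wpM2r// /C addrC lerDl.
Qed.

End Family.

Lemma solves_schrodinger (h : R) V E G : h != 0 -> smooth_on `]0, +oo[ V ->
  schrodinger_solution h V E G -> solves h V E G (deriv_within `[0, +oo[ G).
Proof.
move=> h0 sV sG x x0.
have xI : 0 < x < x + 1 by rewrite x0 ltrDl ltr01.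
have n1 : nbhs x (`[0, +oo[%classic : set R).
  by apply: (nbhs_itv_oo xI) => y /=; rewrite !in_itv/= => /andP[/ltW->].
have n2 : nbhs x (`]0, +oo[%classic : set R).
  by apply: (nbhs_itv_oo xI) => y /=; rewrite !in_itv/= => /andP[->].
have [dG dG' eqG] := sG x (ltW x0).
split.
- have := derivable_within_is_derive n2 (sV 0%N x _).
  by rewrite /= in_itv/= x0 => /(_ isT); exact: is_derive1_continuous.
- exact: derivable_within_is_derive.
- apply: (is_derive1_eq (derivable_within_is_derive n1 dG')).
  move: eqG; rewrite /dern_within /=.
  set G2 := deriv_within _ _ _ => eqG.
  have : h ^+ 2 * G2 = (V x - E) * G x by apply/eqP; rewrite -subr_eq0; apply/eqP; lra.
  by move=> H; rewrite mulrAC -H mulrAC divff ?mul1r// expf_neq0.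
Qed.

Lemma measurable_half_restrict f : measurable_fun (`]0, +oo[%classic : set (measurableTypeR R)) f ->
  measurable_fun [set: measurableTypeR R] (half_restrict f).
Proof.
move=> mf; apply/(measurable_restrictT _ _).1; first exact: measurable_itv.
have -> : `[0, +oo[%classic = [set 0] `|` `]0, +oo[%classic :> set R.
  by rewrite setU1itv.
apply/measurable_funU; [exact: measurable_set1|exact: measurable_itv|].
by split => //; exact: measurable_fun_set1.
Qed.

Lemma measurable_half_solution (h : R) V E G G' : solves h V E G G' ->
  measurable_fun [set: measurableTypeR R] (half_restrict V) /\
  measurable_fun [set: measurableTypeR R] (half_restrict G).
Proof.
move=> sol; split; apply: measurable_half_restrict.
  apply: open_continuous_measurable_fun; first exact: interval_open.
  by move=> x; rewrite inE/= in_itv/= andbT => /sol[].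
apply: open_continuous_measurable_fun; first exact: interval_open.
by move=> x; rewrite inE/= in_itv/= andbT => /sol[_ + _]; exact: is_derive1_continuous.
Qed.

Lemma integral_half_restrict_sqr G :
  (\int[@lebesgue_measure R]_(x in `[0%R, +oo[) (`|G x| ^+ 2)%:E = 1)%E ->
  (\int[@lebesgue_measure R]_x ((half_restrict G x) ^+ 2)%:E = 1)%E.
Proof.
rewrite integral_mkcond => <-; apply: eq_integral => x _.
rewrite /half_restrict !patchE; case: ifP => _; last by rewrite expr0n.
by rewrite real_normK// num_real.
Qed.

End Potentials.

(** * Smooth cut-off functions *)
Section FlatFunctions.
Context {R : realType}.

(** From 1 + v <= exp v at v = u / n. *)
Lemma pow_le_expR n (u : R) : 0 <= u -> u ^+ n <= n%:R ^+ n * expR u.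
Proof.
case: n => [|n] u0; first by rewrite !expr0 mul1r -expR0 ler_expR.
have -> : u ^+ n.+1 = n.+1%:R ^+ n.+1 * (u / n.+1%:R) ^+ n.+1.
  by rewrite -exprMn mulrC divfK// pnatr_eq0.
rewrite ler_wpM2l ?exprn_ge0//.
have -> : expR u = expR (u / n.+1%:R) ^+ n.+1.
  by rewrite -expRM_natl -mulr_natl mulrC divfK// pnatr_eq0.
rewrite lerXn2r ?nnegrE ?expR_ge0 ?divr_ge0//.
by apply: le_trans (expR_ge1Dx _); rewrite lerDr.
Qed.

Lemma poly_le_expR (P : {poly R}) : exists C, 0 <= C /\
  forall u, 0 <= u -> `|P.[u]| <= C * expR u.
Proof.
exists (\sum_(i < size P) `|P`_i| * i%:R ^+ i); split.
  by apply: sumr_ge0 => i _; rewrite mulr_ge0// exprn_ge0.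
move=> u u0; rewrite horner_coef mulr_suml (le_trans (ler_norm_sum _ _ _))//.
apply: ler_sum => i _; rewrite normrM -mulrA ler_wpM2l//.
by rewrite ger0_norm ?exprn_ge0// pow_le_expR.
Qed.

(** The functions P(1/x) exp(-1/x), extended by 0. Allowing a polynomial P makes the family
stable under differentiation. *)
Definition flat (P : {poly R}) (x : R) : R :=
  if 0 < x then P.[x^-1] * expR (- x^-1) else 0.

(** Quadratic decay at 0 makes the derivative at 0 exist and vanish. *)
Lemma flat_le (P : {poly R}) : exists C, 0 <= C /\ forall x, `|flat P x| <= C * x ^+ 2.
Proof.
have [C [C0 HC]] := poly_le_expR (P * 'X^2).
exists C; split => // x; rewrite /flat; case: ltP => [x0|_]; last first.
  by rewrite normr0 mulr_ge0// sqr_ge0.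
have u0 : 0 <= x^-1 by rewrite invr_ge0 ltW.
have := HC _ u0; rewrite hornerM hornerXn normrM (ger0_norm (sqr_ge0 _)) => H.
rewrite normrM (ger0_norm (expR_ge0 _)) expRN ler_pdivrMr ?expR_gt0//.
have x2 : 0 < x ^+ 2 by rewrite exprn_gt0.
rewrite -(ler_pM2r (exprn_gt0 2 (_ : 0 < x^-1))) ?invr_gt0//.
rewrite (le_trans H)// le_eqVlt; apply/orP; left; apply/eqP.
rewrite mulrAC -(mulrA C) -exprMn divff ?gt_eqF// expr1n mulr1 //.
Qed.

Lemma is_derive_flat (P : {poly R}) (x : R) :
  is_derive x 1 (flat P) (flat ('X^2 * (P - P^`())) x).
Proof.
have [x0|x0|->] := ltgtP x 0.
- rewrite {2}/flat ltNge (ltW x0)/=.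
  apply: (near_eq_is_derive (f := cst 0)).
  by near=> y; rewrite /flat ltNge; rewrite ifF//; apply/negbF/ltW; near: y; exact: lt_nbhsl.
- rewrite {2}/flat x0.
  have dV : is_derive x 1 (fun y : R => y^-1) (- (x^-1 ^+ 2)).
    apply: (is_derive1_eq (is_deriveV (f := id) (lt0r_neq0 x0) (is_derive_id x 1))).
    by rewrite /GRing.scale/= mulr1 exprVn.
  have dP := @is_derive1_comp _ (horner P) (fun y => y^-1) x _ _ (is_derive_poly P _) dV.
  have dE := @is_derive1_comp _ expR (fun y => - y^-1) x _ _ (is_derive_expR _)
    (is_derive1N dV).
  apply: (@near_eq_is_derive _ _ _ (fun y : R => P.[y^-1] * expR (- y^-1))).
    by near=> y; rewrite /flat ifT//; near: y; exact: lt_nbhsr.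
  apply: (is_derive1_eq (is_derive1M dP dE)).
  by rewrite /= hornerM hornerXn hornerD hornerN; ring.
- rewrite {2}/flat ltxx.
  have [C [C0 HC]] := flat_le P.
  apply/is_derive1_caratheodory; exists (fun z => flat P z / z); split.
  + move=> z; rewrite subr0 {2}/flat ltxx subr0.
    by have [->|z0] := eqVneq z 0; [rewrite mulr0 /flat ltxx|rewrite divfK].
  + apply/cvgrPdist_le => /= e e0.
    have eC : 0 < e / (C + 1) by rewrite divr_gt0// ltr_wpDl.
    have nz : \forall z \near (0 : R), `|z| <= e / (C + 1).
      by have := @nbhs0_le R R _ eC.
    near=> z; rewrite invr0 mulr0 sub0r normrN normrM normfV.
    have [->|z0] := eqVneq z 0; first by rewrite normr0 invr0 mulr0 ltW.
    rewrite ler_pdivrMr ?normr_gt0//; apply: (le_trans (HC z)).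
    rewrite -(real_normK (num_real z)) expr2 mulrA ler_wpM2r//.
    have : `|z| <= e / (C + 1).
      by near: z.
    rewrite ler_pdivlMr ?ltr_wpDl// mulrDr mulr1 mulrC; have := normr_ge0 z; lra.
  + by rewrite invr0 mulr0.
Unshelve. all: by end_near.
Qed.

Lemma Dk_flat k (P : {poly R}) : Dk k setT (flat P).
Proof.
elim: k P => [|k IH] P; first by split=> // x _; have [] := is_derive_flat P x.
have dP x : [set: R] x -> is_derive x 1 (flat P) (flat ('X^2 * (P - P^`())) x).
  by move=> _; exact: is_derive_flat.
exact: (@Dk_intro _ k setT (flat P) (flat ('X^2 * (P - P^`()))) openT dP (IH _)).
Qed.

Lemma Dk_comp_affine k (f : R -> R) (p q : R) : Dk k setT f ->
  Dk k setT (fun x => f (p + q * x)).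
Proof.
elim: k f => [|k IH] f Df.
  by split=> // x _; have [] := is_derive1_comp_affine (Dk_is Df (I : setT (p + q * x))).
have df x : [set: R] x -> is_derive x 1 (fun x => f (p + q * x)) (q * derive1 f (p + q * x)).
  by move=> _; apply: is_derive1_comp_affine; exact: (Dk_is Df).
apply: (@Dk_intro _ k setT _ (fun x => q * derive1 f (p + q * x)) openT df).
apply: DkM; [exact: openT|apply: Dk_cst; exact: openT|].
exact: (IH _ (proj2 Df)).
Qed.

Definition smooth_bump (c r : R) (x : R) : R :=
  flat 1 ((r - c) + 1 * x) * flat 1 ((r + c) + -1 * x).

Lemma flat1E x : flat 1 x = if 0 < x then expR (- x^-1) else 0.
Proof. by rewrite /flat hornerC mul1r. Qed.

Lemma flat1_ge0 x : 0 <= flat 1 x.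
Proof. by rewrite flat1E; case: ifP => // _; exact: expR_ge0. Qed.

Lemma Dk_smooth_bump k c r : Dk k setT (smooth_bump c r).
Proof. by apply: DkM; [exact: openT|exact: Dk_comp_affine (Dk_flat _ _)..]. Qed.

Lemma smooth_bump_ge0 c r x : 0 <= smooth_bump c r x.
Proof. by rewrite mulr_ge0// flat1_ge0. Qed.

Lemma smooth_bump_gt0 c r x : `|x - c| < r -> 0 < smooth_bump c r x.
Proof.
rewrite ltr_distl => /andP[? ?].
by rewrite /smooth_bump !flat1E !ifT ?mulr_gt0 ?expR_gt0//; lra.
Qed.

Lemma smooth_bump_off c r : vanishes_off (c - r) (c + r) (smooth_bump c r).
Proof.
move=> x; rewrite negb_and -!ltNge /smooth_bump !flat1E => /orP[H|H].
  by rewrite ifF ?mul0r//; apply/negbTE; rewrite -leNgt; lra.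
by rewrite [X in _ * X]ifF ?mulr0//; apply/negbTE; rewrite -leNgt; lra.
Qed.

Lemma cs_bounded (f : R -> R) (p q : R) : continuous f -> vanishes_off p q f ->
  exists K, 0 <= K /\ forall x, `|f x| <= K.
Proof.
move=> cf zf; have [K [K0 HK]] := compact_bounded_real (@segment_compact _ p q)
  (continuous_subspaceT cf).
exists K; split => // x; have [H|H] := boolP (p <= x <= q).
  by apply: HK; rewrite /= in_itv.
by rewrite zf// normr0.
Qed.

(** A bump function centred at 0, normalized at 0. *)
Lemma exists_cutoff : exists (X : R) chi chi1 chi2, is_cutoff X chi chi1 chi2.
Proof.
pose b := smooth_bump 0 1; have b0 : 0 < b 0 by apply: smooth_bump_gt0; rewrite subrr normr0.
pose chi x := (b 0)^-1 * b x.
have Dchi : Dk 2 setT chi.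
  by apply: DkM; [exact: openT|apply: Dk_cst; exact: openT|exact: Dk_smooth_bump].
have D1 : Dk 1 setT (derive1 chi) := proj2 Dchi.
have D2 : Dk 0 setT (derive1 (derive1 chi)) := proj2 D1.
have d0 (r : R) : is_derive r 1 chi (derive1 chi r) := Dk_is Dchi (I : setT r).
have d1 (r : R) : is_derive r 1 (derive1 chi) (derive1 (derive1 chi) r) :=
  Dk_is D1 (I : setT r).
have d2 (r : R) : is_derive r 1 (derive1 (derive1 chi)) _ :=
  Dk_is D2 (I : setT r).
have z0 : vanishes_off (-1) 1 chi.
  have zb := @smooth_bump_off 0 1; rewrite sub0r add0r in zb.
  by move=> x H; rewrite /chi /b (zb x H) mulr0.
have z1 := cs_derive_vanishes z0 d0; have z2 := cs_derive_vanishes z1 d1.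
have c0 : continuous chi by move=> r; exact: is_derive1_continuous (d0 r).
have c1 : continuous (derive1 chi) by move=> r; exact: is_derive1_continuous (d1 r).
have c2 : continuous (derive1 (derive1 chi)).
  by move=> r; exact: is_derive1_continuous (d2 r).
have [K0 [K00 H0]] := cs_bounded c0 z0; have [K1 [K10 H1]] := cs_bounded c1 z1.
have [K2 [K20 H2]] := cs_bounded c2 z2.
exists (K0 + K1 + K2), chi, (derive1 chi), (derive1 (derive1 chi)); split => //.
move=> r; split.
- by apply: (le_trans (H0 r)); rewrite -addrA lerDl addr_ge0.
- by apply: (le_trans (H1 r)); rewrite addrAC lerDr addr_ge0.
- by apply: (le_trans (H2 r)); rewrite lerDr addr_ge0.
have chi0 : chi 0 = 1 by rewrite /chi mulVf// gt_eqF.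
have := @mean_value_le _ chi (derive1 chi) r 0 K1 (fun x _ => d0 x) (fun x _ => H1 x).
rewrite chi0 sub0r normrN => H; apply: (le_trans H); rewrite ler_wpM2r//.
by rewrite addrAC lerDr addr_ge0.
Qed.

Lemma Ck_comp_fst k (f : R -> R) : Dk k setT f -> Ck k (fun z : R * R => f z.1).
Proof.
have ct (g : R -> R) : (forall x : R, derivable g x 1) -> continuous (fun z : R * R => g z.1).
  move=> dg; apply: (@continuous_compose _ _ _ fst g); first by move=> z; exact: cvg_fst.
  by move=> x; apply: is_derive1_continuous; exact: derivable_is_derive1.
elim: k f => [|k IH] f Df; first by split=> //; apply: ct => x; exact: (Dk_derivable Df).
apply: (Ck_intro (f1 := fun z => derive1 f z.1) (f2 := fun _ : R * R => 0 : R)).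
- by apply: ct => x; exact: (Dk_derivable Df).
- by move=> x xi; exact: (Dk_is Df).
- by move=> x xi; exact: (is_derive_cst (f x) xi 1).
- exact: (IH _ (proj2 Df)).
- exact: Ck_cst.
Qed.

Lemma Ck_comp_snd k (f : R -> R) : Dk k setT f -> Ck k (fun z : R * R => f z.2).
Proof.
have ct (g : R -> R) : (forall x : R, derivable g x 1) -> continuous (fun z : R * R => g z.2).
  move=> dg; apply: (@continuous_compose _ _ _ snd g); first by move=> z; exact: cvg_snd.
  by move=> x; apply: is_derive1_continuous; exact: derivable_is_derive1.
elim: k f => [|k IH] f Df; first by split=> //; apply: ct => x; exact: (Dk_derivable Df).
apply: (Ck_intro (f1 := fun _ : R * R => 0 : R) (f2 := fun z => derive1 f z.2)).
- by apply: ct => x; exact: (Dk_derivable Df).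
- by move=> x xi; exact: (is_derive_cst (f xi) x 1).
- by move=> x xi; exact: (Dk_is Df).
- exact: Ck_cst.
- exact: (IH _ (proj2 Df)).
Qed.

Lemma boxsym_smooth_bump (x0 xi0 r : R) :
  boxsym (x0 - r) (x0 + r) (`|xi0| + r) (fun z => smooth_bump x0 r z.1 * smooth_bump xi0 r z.2).
Proof.
split.
  by move=> k; apply: CkM; [exact: Ck_comp_fst (Dk_smooth_bump _ _ _)|exact: Ck_comp_snd (Dk_smooth_bump _ _ _)].
move=> x xi; rewrite negb_and => /orP[H|H]; first by rewrite /= smooth_bump_off ?mul0r.
rewrite /= [X in _ * X]smooth_bump_off ?mulr0//; apply: contra H => /andP[H1 H2].
have := ler_norm xi0; have := ler_norm (- xi0); rewrite normrN.
by move=> ? ?; apply/andP; split; lra.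
Qed.

End FlatFunctions.

Local Open Scope complex_scope.

(** * Semiclassical functionals of real symbols *)
Section RealSymbols.
Context {R : realType}.
Notation mu := (@lebesgue_measure R).

Lemma Re_mul_real (z : R[i]) (r : R) : complex.Re (z * r%:C) = complex.Re z * r.
Proof. by case: z => x y /=; rewrite mulr0 subr0. Qed.

Lemma Re_mul_conj_real (z : R[i]) (r : R) : complex.Re (z * conjc r%:C) = complex.Re z * r.
Proof. by case: z => x y /=; rewrite oppr0 mulr0 subr0. Qed.

Lemma Re_real_mul (z : R[i]) (r : R) : complex.Re (r%:C * z) = r * complex.Re z.
Proof. by case: z => x y /=; rewrite mul0r subr0. Qed.

Lemma Re_op_kernel t h (a : R * R -> R) x y :
  complex.Re (op_kernel t h (fun z => (a z)%:C) x y) =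
  (2 * pi * h)^-1 * diag_osc t h a (x, y).
Proof.
rewrite /op_kernel Re_real_mul; congr (_ * _) => /=.
apply: eq_Rintegral => xi _; rewrite /Re_fun Re_mul_real /= addr0.
by congr (cos _ * _); rewrite mulrAC.
Qed.

Lemma Re_mu_h al be M t h (G : R -> R) (a : R * R -> R) : boxsym al be M a ->
  0 < h ->
  measurable_fun [set: measurableTypeR R] (half_restrict G) ->
  (\int[mu]_x ((half_restrict G x) ^+ 2)%:E = 1)%E ->
  complex.Re (mu_h t h G (fun z => (a z)%:C)) =
  (2 * pi * h)^-1 * quad (half_restrict G) (diag_osc t h a).
Proof.
move=> sa h0 mG G1.
have [K [_ /(_ h h0) da]] := diag_osc_dominated t sa.
have dc := dominatedZ (2 * pi * h)^-1 da.
rewrite /quad -RintegralZl//; last exact: (quad_integrable mG G1 h0 da).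
transitivity (quad (half_restrict G) (fun z => (2 * pi * h)^-1 * diag_osc t h a z)).
  rewrite (quad_iter12 mG G1 h0 dc) /mu_h /L2_inner /cintegral /=.
  apply: eq_Rintegral => x _; rewrite /Re_fun Re_mul_conj_real; congr (_ * _).
  rewrite /Op /cintegral /=; apply: eq_Rintegral => y _.
  by rewrite /Re_fun Re_mul_real Re_op_kernel.
by apply: eq_Rintegral => z _; rewrite [RHS]mulrA.
Qed.

(** The support is closed in the compact box. *)
Lemma symbol_boxsym al be M d (a : R * R -> R) : 0 < al -> be < d -> boxsym al be M a ->
  symbol d (fun z => (a z)%:C).
Proof.
move=> al0 bed sa.
pose B : set (R * R) := `[al, be]%classic `*` `[- M, M]%classic.
have cB : compact B by exact: compact_box.
have clB : closed B by apply: compact_closed cB; exact: norm_hausdorff.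
have sB : closure [set z | (a z)%:C != 0] `<=` B.
  rewrite closureE => z; apply; split => // -[x xi] /= H.
  have : a (x, xi) != 0 by apply: contra_neq H => ->.
  move=> {}H; have : (al <= x <= be) && (- M <= xi <= M).
    by apply: contraNT H => H; rewrite sa.2.
  by move=> /andP[? ?]; split; rewrite /= in_itv.
split.
- exact: sa.1.
- by move=> k; exact: Ck_cst.
- by apply: (subclosed_compact _ cB sB); exact: closed_closure.
- move=> z /sB[] /=; rewrite !in_itv/= => /andP[? ?] _.
  by rewrite /phase_domain /=; apply/andP; split; lra.
Qed.

(** On the compact support, 1 / x, 1 / (d - x) and xi are bounded; this gives the box without
any discussion of whether the support is empty. *)
Lemma boxsym_symbol d (a : R * R -> R[i]) : symbol d a ->
  exists al be M, [/\ 0 < al, be < d, boxsym al be M (Re_fun a) & boxsym al be M (Im_fun a)].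
Proof.
move=> [sR sI cS sS]; set S := closure _ in cS sS.
have c1 : {within S, continuous (fun z : R * R => (z.1)^-1)}.
  apply: continuous_in_subspaceT => z; rewrite inE => /sS /andP[z0 _].
  by apply: cvgV; [rewrite gt_eqF|exact: cvg_fst].
have c2 : {within S, continuous (fun z : R * R => (d - z.1)^-1)}.
  apply: continuous_in_subspaceT => z; rewrite inE => /sS /andP[_ zd].
  apply: cvgV; first by rewrite gt_eqF// subr_gt0.
  by apply: cvgB; [exact: cvg_cst|exact: cvg_fst].
have c3 : {within S, continuous (fun z : R * R => z.2)}.
  by apply: continuous_subspaceT => z; exact: cvg_snd.
have [K1 [K10 H1]] := compact_bounded_real cS c1.
have [K2 [K20 H2]] := compact_bounded_real cS c2.
have [M [M0 HM]] := compact_bounded_real cS c3.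
have inv_bound (u K : R) : 0 <= K -> 0 < u -> `|u^-1| <= K -> (K + 1)^-1 <= u.
  have H0 : 0 < u -> 0 < u^-1 by rewrite invr_gt0.
  move=> K0 u0; rewrite (gtr0_norm (H0 u0)) => uK.
  rewrite -[leRHS]invrK lef_pV2 ?posrE ?invr_gt0//; last by rewrite ltr_wpDl.
  by rewrite (le_trans uK)// lerDl.
have box x xi : ~~ (((K1 + 1)^-1 <= x <= d - (K2 + 1)^-1) && (- M <= xi <= M)) ->
    a (x, xi) = 0.
  move=> H; apply/eqP; apply: contraNT H => H.
  have Sz : S (x, xi) by apply: subset_closure.
  have /andP[/= x0 xd] := sS _ Sz.
  have h1 := inv_bound _ _ K10 x0 (H1 _ Sz).
  have xd' : 0 < d - x by rewrite subr_gt0.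
  have h2 := inv_bound _ _ K20 xd' (H2 _ Sz).
  have := HM _ Sz; rewrite /= ler_norml => hM.
  by rewrite hM andbT h1/=; lra.
exists (K1 + 1)^-1, (d - (K2 + 1)^-1), M; split.
- by rewrite invr_gt0 ltr_wpDl.
- by rewrite ltrBlDr ltrDl invr_gt0 ltr_wpDl.
- by split => // x xi H; rewrite /Re_fun box.
- by split => // x xi H; rewrite /Im_fun box.
Qed.

Lemma small_cvg0 (u : nat -> R) (C : R) : 0 <= C ->
  (forall eps, 0 < eps -> \forall n \near \oo, `|u n| <= C * eps) -> u @ \oo --> (0 : R).
Proof.
move=> C0 H; apply/cvgrPdist_le => /= e e0.
have C1 : 0 < C + 1 by rewrite ltr_wpDl.
have := H (e / (C + 1)) (divr_gt0 e0 C1).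
apply: filterS => n Hn; rewrite sub0r normrN (le_trans Hn)//.
rewrite mulrCA ler_piMr ?(ltW e0)// ler_pdivrMr// mul1r lerDl//.
Qed.

Lemma lipschitz_Dk d (f : R -> R) p q : Dk 1 `]0, d[ f -> 0 < p -> q < d ->
  exists L, 0 <= L /\ forall x y, p <= x <= q -> p <= y <= q ->
    `|f x - f y| <= L * `|x - y|.
Proof.
move=> Df p0 qd.
have pqd x : p <= x <= q -> `]0, d[%classic x.
  by move=> /andP[px xq]; rewrite /= in_itv/=; apply/andP; split; lra.
have cf : {within `[p, q], continuous (derive1 f)}.
  apply: continuous_in_subspaceT => x; rewrite inE/= in_itv/= => /pqd xd.
  exact: is_derive1_continuous (Dk_is (proj2 Df : Dk 0 _ _) xd).
have [L [L0 HL]] := compact_bounded_real (@segment_compact _ p q) cf.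
exists L; split => // x y xI yI.
have betw z : Num.min y x <= z <= Num.max y x -> p <= z <= q.
  move: xI yI => /andP[? ?] /andP[? ?] /andP[].
  by case: (leP y x) => _ ? ?; apply/andP; split; lra.
apply: (@mean_value_le _ f (derive1 f)) => z /betw zI.
  exact: (Dk_is Df (pqd _ zI)).
by apply: HL; rewrite /= in_itv.
Qed.

End RealSymbols.

(** * Limits along the family *)
Section FamilyLimits.
Context {R : realType}.
Variables (gamma d t : R) (h E : nat -> R) (V W G : nat -> R -> R) (E0 : R) (W0 : R -> R).
Hypotheses (t01 : 0 <= t <= 1) (h_gt0 : forall n, 0 < h n) (h_cvg : h @ \oo --> (0 : R)).
Hypothesis V_smooth : forall n, smooth_on `]0, +oo[ (V n).
Hypothesis W_smooth : forall n, smooth_on `[0, +oo[ (W n).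
Hypothesis VE : forall n x, 0 < x -> V n x = x `^ gamma * W n x.
Hypothesis W0_smooth : smooth_on `[0, d] W0.
Hypothesis W_cvg : (W : nat -> Cinfty d) @ \oo --> (W0 : Cinfty d).
Hypothesis E_cvg : E @ \oo --> E0.
Hypothesis G_sol : forall n, is_Gh d (h n) (V n) (E n) (G n).

Let V0 x := x `^ gamma * W0 x.

Let G' n := deriv_within `[0, +oo[ (G n).

Let sol n : solves (h n) (V n) (E n) (G n) (G' n).
Proof.
by have [sG _ _] := G_sol n; apply: solves_schrodinger sG => //; rewrite gt_eqF.
Qed.

Let mG n : measurable_fun [set: measurableTypeR R] (half_restrict (G n)).
Proof. by have [] := measurable_half_solution (@sol n). Qed.

Let mV n : measurable_fun [set: measurableTypeR R] (half_restrict (V n)).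
Proof. by have [] := measurable_half_solution (@sol n). Qed.

Let G1 n : (\int[@lebesgue_measure R]_x ((half_restrict (G n) x) ^+ 2)%:E = 1)%E.
Proof. by have [_ G1 _] := G_sol n; exact: integral_half_restrict_sqr. Qed.

Let DV0 k : Dk k `]0, d[ V0.
Proof. exact: Dk_potential. Qed.

(** The width de of the cut-off leaves room on both sides of the support of the symbol. *)
Let room al be : 0 < al -> be < d -> exists de, [/\ 0 < de, 0 < al - de & be + de < d].
Proof.
move=> al0 bed; exists (Num.min al (d - be) / 2).
by case: (leP al (d - be)) => ?; split; lra.
Qed.

Let mu_le n al be M (a : R * R -> R) K eps : boxsym al be M a -> 0 <= K ->
  `|quad (half_restrict (G n)) (diag_osc t (h n) a)| <= K * (h n + eps) * (h n * pi) ->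
  h n <= eps ->
  `|complex.Re (mu_h t (h n) (G n) (fun z => (a z)%:C))| <= K * eps.
Proof.
move=> sa K0 Hq heps.
rewrite (Re_mu_h t sa (h_gt0 n) (@mG n) (G1 n)) normrM.
have hp : 0 < 2 * pi * h n :> R by rewrite !mulr_gt0// pi_gt0.
rewrite normfV (gtr0_norm hp) ler_pdivrMl//; apply: (le_trans Hq).
rewrite [leRHS](_ : _ = K * (eps + eps) * (h n * pi)); last by ring.
rewrite ler_wpM2r ?mulr_ge0 ?pi_ge0 ?(ltW (h_gt0 n))// ler_wpM2l// lerD2r//.
Qed.

Let eventually p q (eps : R) : 0 < p -> q < d -> 0 < eps ->
  \forall n \near \oo, [/\ h n <= 1, h n <= eps, `|E0 - E n| <= eps &
    forall x : R, p <= x <= q -> [/\ is_derive x 1 (V n) (derive1 (V n) x),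
      `|V n x - V0 x| <= eps & `|derive1 (V n) x - derive1 V0 x| <= eps]].
Proof.
move=> p0 qd eps0.
have H1 := potential_cvg (gamma := gamma) p0 qd W_smooth W0_smooth VE W_cvg eps0.
have H2 : \forall n \near \oo, `|0 - h n| <= Num.min 1 eps.
  by move/cvgrPdist_le : h_cvg; apply; rewrite lt_min ltr01.
have H3 : \forall n \near \oo, `|E0 - E n| <= eps.
  by move/cvgrPdist_le : E_cvg; apply.
near=> n; split.
- have : `|0 - h n| <= Num.min 1 eps by near: n.
  by rewrite sub0r normrN (gtr0_norm (h_gt0 n)) le_min => /andP[].
- have : `|0 - h n| <= Num.min 1 eps by near: n.
  by rewrite sub0r normrN (gtr0_norm (h_gt0 n)) le_min => /andP[].
- by near: n.
- by near: n; exact: H1.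
Unshelve. all: by end_near. Qed.

Let al_be_sub al be de x : 0 < al - de -> be + de < d -> 0 < de -> al <= x <= be ->
  `]0, d[%classic x.
Proof. by move=> ? ? ? /andP[? ?]; rewrite /= in_itv/=; apply/andP; split; lra. Qed.

Lemma energy_limit al be M (a : R * R -> R) : 0 < al -> be < d -> boxsym al be M a ->
  let b := fun z => z.2 * (z.2 * a z) + (V0 z.1 - E0) * a z in
  boxsym al be M b /\
  (fun n => complex.Re (mu_h t (h n) (G n) (fun z => (b z)%:C))) @ \oo --> (0 : R).
Proof.
move=> al0 bed sa b.
have [de [de0 p0 qd]] := room al0 bed.
have oI : open (`]0, d[%classic : set R) by exact: interval_open.
have DVE k : Dk k `]0, d[ (fun x => V0 x - E0).
  by apply: DkD; [exact: oI|exact: DV0|exact: Dk_cst].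
have sc : boxsym al be M (fun z => (V0 z.1 - E0) * a z).
  apply: (boxsym_mulV (V := fun x => V0 x - E0) oI _ DVE sa) => x.
  exact: al_be_sub p0 qd de0.
have sb : boxsym al be M b by apply: boxsymD => //; do 2 apply: boxsym_xi.
split; first exact: sb.
have [X [chi [chi1 [chi2 cut]]]] := @exists_cutoff R.
have [L [L0 HL]] := lipschitz_Dk (DV0 1) p0 qd.
have [K [K0 HK]] := energy_estimate cut de0 t01 p0 (E0 := E0) sa sc L0 HL.
apply: (@small_cvg0 _ _ (K * 2)); first by rewrite mulr_ge0.
move=> eps eps0; have := eventually p0 qd eps0; apply: filterS => n [h1 heps Eeps Vn].
have eps20 : 0 <= eps + eps by rewrite addr_ge0 ?ltW.
rewrite -mulrA (_ : 2 * eps = eps + eps); last by ring.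
apply: (mu_le sb K0); last by apply: (le_trans heps); rewrite lerDl ltW.
apply: (HK (h n) (V n) (E n) (G n) (@G' n)).
- by rewrite h_gt0.
- exact: eps20.
- exact: (@sol n).
- exact: (@mV n).
- exact: (@mG n).
- exact: G1.
- move=> x xI; have [_ Vx _] := Vn x xI.
  rewrite (_ : _ - _ = - (V n x - V0 x) + - (E0 - E n)); last by ring.
  by apply: normD_le; rewrite normrN.
Qed.

Lemma flow_limit al be M (a : R * R -> R) : 0 < al -> be < d -> boxsym al be M a ->
  let b := fun z => 2 * (z.2 * dx a z) + -1 * (derive1 V0 z.1 * dxi a z) in
  boxsym al be M b /\
  (fun n => complex.Re (mu_h t (h n) (G n) (fun z => (b z)%:C))) @ \oo --> (0 : R).
Proof.
move=> al0 bed sa b.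
have [de [de0 p0 qd]] := room al0 bed.
have oI : open (`]0, d[%classic : set R) by exact: interval_open.
have DdV k : Dk k `]0, d[ (derive1 V0) := proj2 (DV0 k.+1).
have sc : boxsym al be M (fun z => derive1 V0 z.1 * dxi a z).
  apply: (boxsym_mulV oI _ DdV (boxsym_dxi sa)) => x.
  exact: al_be_sub p0 qd de0.
have sb : boxsym al be M b.
  by apply: boxsymD; apply: boxsymZ => //; apply: boxsym_xi; exact: boxsym_dx.
split; first exact: sb.
have [X [chi [chi1 [chi2 cut]]]] := @exists_cutoff R.
have [L [L0 HL]] := lipschitz_Dk (DdV 1) p0 qd.
have [K [K0 HK]] := flow_estimate cut de0 t01 p0 sa sc L0 HL.
apply: (@small_cvg0 _ _ K) => //.
move=> eps eps0; have := eventually p0 qd eps0; apply: filterS => n [h1 heps Eeps Vn].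
apply: (mu_le sb K0) => //.
apply: (HK (h n) (V n) (derive1 (V n)) (E n) (G n) (@G' n)).
- by rewrite h_gt0.
- exact: ltW.
- exact: (@sol n).
- exact: (@mV n).
- exact: (@mG n).
- exact: G1.
- by move=> x xI; have [? _ ?] := Vn x xI.
Qed.

End FamilyLimits.

(** * The limit measure *)
Section LimitMeasure.
Context {R : realType}.

(** The real-valued integral is also 0 when the extended one is infinite, so integrability has
to be checked first: b is bounded and supported in a box, of finite mass. Then
|b| = sg b integrates to 0 and b vanishes almost everywhere. *)
Lemma null_of_Rintegral0 (d al be M : R) (m : {measure set (plane R) -> \bar R})
    (b : R * R -> R) (sg : R) (U : set (R * R)) :
  measure_on_domain d m -> 0 < al -> be < d -> boxsym al be M b ->
  (forall z, 0 <= sg * b z) -> (forall z, U z -> b z != 0) ->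
  measurable (U : set (plane R)) -> `|sg| = 1 ->
  Rintegral m (phase_domain d) b = 0 -> m U = 0.
Proof.
move=> [m0 mfin] al0 bed sb sg0 Ub mU sg1.
pose B : set (R * R) := `[al, be]%classic `*` `[- M, M]%classic.
have mB : measurable (B : set (plane R)) by apply: measurableX; exact: measurable_itv.
have Bd : B `<=` phase_domain d.
  move=> z [] /=; rewrite !in_itv/= => /andP[? ?] _.
  by rewrite /phase_domain /=; apply/andP; split; lra.
have mBoo : (m B < +oo)%E by apply: mfin => //; exact: compact_box.
have b0 z : ~ B z -> b z = 0.
  case: z => x xi nB; apply: sb.2; apply/negP => /andP[? ?]; apply: nB.
  by split; rewrite /= in_itv.
have -> : Rintegral m (phase_domain d) b = Rintegral m B b.
  rewrite Rintegral_mkcond [RHS]Rintegral_mkcond; congr (Rintegral _ _ _).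
  apply/funext => z; rewrite !patchE; case: ifPn => zd; case: ifPn => zB //.
  - by rewrite b0//; move: zB; rewrite notin_setE.
  - by move: zd; rewrite notin_setE; case; apply: Bd; rewrite inE in zB.
have cb := Ck_cont (sb.1 0%N).
have mb : measurable_fun [set: plane R] b by exact: continuous_plane_measurable.
have [K [K0 HK]] := boxsym_bounded sb.
have ib : m.-integrable B (EFin \o b).
  apply: measurable_bounded_integrable => //; first exact: measurable_funTS.
  exists K; split; first exact: num_real.
  by move=> x Kx z _; apply: (le_trans (HK z)); exact: ltW.
move=> ib0.
have ab z : `|b z| = sg * b z by rewrite -[LHS]mul1r -sg1 -normrM ger0_norm.
have iab0 : (\int[m]_(z in B) `|(b z)%:E| = 0)%E.
  have iab : m.-integrable B (EFin \o (fun z => `|b z|)).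
    rewrite (_ : (fun z => _) = fun z => sg * b z); last by apply/funext.
    exact: integrable_EFinZ.
  have : \int[m]_(z in B) `|b z| = 0.
    under eq_Rintegral do rewrite ab.
    by rewrite RintegralZl// ib0 mulr0.
  rewrite /Rintegral => fz; rewrite -[LHS]fineK; first by rewrite fz.
  exact: (integrable_fin_num _ iab).
have mbB : measurable_fun B (EFin \o b) by apply/measurable_EFinP; exact: measurable_funTS.
have [N [mN N0 sN]] := (ae_eq_integral_abs m mB mbB).1 iab0.
have UN : U `<=` N.
  move=> z Uz; apply: sN => /= H.
  have Bz : B z by apply: contrapT => /b0 /eqP; apply/negP; exact: Ub.
  by have /eqP := Ub z Uz; apply; have [] := H Bz.
by apply/eqP; rewrite eq_le measure_ge0 andbT -N0 le_measure// inE.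
Qed.

End LimitMeasure.

Section Conclusion.
Context {R : realType}.

Lemma Rintegral_limit_eq0 (d t : R) (h : nat -> R) (G : nat -> R -> R)
    (m : {measure set (plane R) -> \bar R}) al be M (b : R * R -> R) :
  (forall a : R * R -> R[i], symbol d a ->
     ccvg (fun n => mu_h t (h n) (G n) a) (cintegral m (phase_domain d) a)) ->
  0 < al -> be < d -> boxsym al be M b ->
  (fun n => complex.Re (mu_h t (h n) (G n) (fun z => (b z)%:C))) @ \oo --> (0 : R) ->
  Rintegral m (phase_domain d) b = 0.
Proof.
move=> Hm al0 bed sb b0.
have [+ _] := Hm _ (symbol_boxsym al0 bed sb).
by move=> /cvg_unique; apply.
Qed.

(** The real and imaginary parts of the Poisson bracket are the real symbols treated by
[flow_limit]. *)
Lemma poisson_kinetic (V : R -> R) (a : R * R -> R[i]) (z : R * R) : derivable V z.1 1 ->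
  poisson (fun z => z.2 ^+ 2 + V z.1) a z =
  (2 * (z.2 * dx (Re_fun a) z) + -1 * (derive1 V z.1 * dxi (Re_fun a) z))
  +i* (2 * (z.2 * dx (Im_fun a) z) + -1 * (derive1 V z.1 * dxi (Im_fun a) z)).
Proof.
move=> /derivable_is_derive1 dV; rewrite /poisson.
have -> : dxi (fun z => z.2 ^+ 2 + V z.1) z = 2 * z.2.
  apply: is_derive1_val.
  apply: (is_derive1_eq (is_derive1D (is_deriveX 2 (is_derive_id z.2 1))
    (is_derive_cst (V z.1) z.2 1))).
  by rewrite /GRing.scale /= addr0 mulr1 expr1.
have -> : dx (fun z => z.2 ^+ 2 + V z.1) z = derive1 V z.1.
  apply: is_derive1_val.
  by apply: (is_derive1_eq (is_derive1D (is_derive_cst (z.2 ^+ 2) z.1 1) dV)); rewrite add0r.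
do ![move: (dx _ _) => ?]; do ![move: (dxi _ _) => ?]; move: (derive1 V _) z.2 => ? ?.
by simpc; congr (_ +i* _); ring.
Qed.

(** The sign sg of p0 - E0 at z persists on a box around z; the box is chosen inside the
phase domain. *)
Lemma off_surface_box (d : R) (V : R -> R) (E0 : R) (z : R * R) :
  (forall x, 0 < x < d -> {for x, continuous V}) -> phase_domain d z ->
  z.2 ^+ 2 + V z.1 != E0 ->
  exists (r sg : R), [/\ 0 < r, `|sg| = 1, 0 < z.1 - r, z.1 + r < d &
    forall w, `|w.1 - z.1| <= r -> `|w.2 - z.2| <= r ->
      0 < sg * (w.2 ^+ 2 + (V w.1 - E0))].
Proof.
move=> cV zd; rewrite -subr_eq0 -addrA => q0.
pose q (w : R * R) := w.2 ^+ 2 + (V w.1 - E0); rewrite -/(q z) in q0.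
have cq : {for z, continuous q}.
  have c1 : w.1 @[w --> z] --> z.1 by exact: cvg_fst.
  have c2 : w.2 @[w --> z] --> z.2 by exact: cvg_snd.
  apply: cvgD; first exact: (cvgM c2 c2).
  by apply: cvgB; [exact: (cvg_comp _ _ c1 (cV _ zd))|exact: cvg_cst].
have cf : {for z, continuous (fst : R * R -> R)} by exact: cvg_fst.
pose sg := Num.sg (q z).
have sgq : 0 < sg * q z by rewrite -normrEsg normr_gt0.
have csq : sg * q w @[w --> z] --> sg * q z by apply: cvgM; [exact: cvg_cst|exact: cq].
have /andP[z0 z1] := zd.
have N1 : \forall w \near z, 0 < sg * q w by apply: (cvgr_gt _ csq).
have N2 : \forall w \near z, 0 < w.1 by apply: (cvgr_gt _ cf).
have N3 : \forall w \near z, w.1 < d by apply: (cvgr_lt _ cf).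
have /nbhs_ballP[e /= e0 He] : \forall w \near z, [/\ 0 < sg * q w, 0 < w.1 & w.1 < d].
  by near=> w; split; near: w.
have r0 : 0 < e / 2 by rewrite divr_gt0.
have re : e / 2 < e by rewrite ltr_pdivrMr// ltr_pMr// ltr1n.
have inB (w : R * R) : `|w.1 - z.1| <= e / 2 -> `|w.2 - z.2| <= e / 2 -> ball z e w.
  by move=> w1 w2; split; rewrite /ball /= distrC; apply: le_lt_trans re.
exists (e / 2), sg; split=> //.
- by rewrite normr_sg q0.
- have [] := He (z.1 - e / 2, z.2).
    by apply: inB => /=; rewrite ?subrr ?normr0 ?(ltW r0)// addrAC subrr sub0r normrN gtr0_norm.
  by [].
- have [] := He (z.1 + e / 2, z.2).
    by apply: inB => /=; rewrite ?subrr ?normr0 ?(ltW r0)// addrAC subrr add0r gtr0_norm.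
  by [].
- by move=> w w1 w2; have [] := He w (inB w w1 w2).
Unshelve. all: by end_near. Qed.

End Conclusion.

Local Close Scope complex_scope.
Unset Implicit Arguments.

Theorem proposition4p4 (R : realType) (gamma b c d t : R)
    (KK : set (Cinfty d)) (K : set R)
    (h E : nat -> R) (V W G : nat -> R -> R) (E0 : R) (W0 : R -> R)
    (mu0 : {measure set (plane R) -> \bar R}) :
  0 < gamma -> 0 < b -> b < c -> c < d ->
  0 <= t <= 1 ->
  (forall f : R -> R, KK f -> smooth_on `[0, d] f) -> compact KK ->
  compact K -> K `<=` `]0, +oo[ ->
  (forall n, 0 < h n) -> h @ \oo --> (0 : R) ->
  (forall n, potential_with gamma b c KK K (V n) (W n)) ->
  (forall n, K (E n)) ->
  smooth_on `[0, d] W0 ->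
  (W : nat -> Cinfty d) @ \oo --> (W0 : Cinfty d) ->
  E @ \oo --> E0 ->
  (forall n, is_Gh d (h n) (V n) (E n) (G n)) ->
  measure_on_domain d mu0 ->
  (forall a : R * R -> R[i], symbol d a ->
     ccvg (fun n => mu_h t (h n) (G n) a) (cintegral mu0 (phase_domain d) a)) ->
  let V0 := fun x : R => x `^ gamma * W0 x in
  let p0 := fun z : R * R => z.2 ^+ 2 + V0 z.1 in
  msupport d mu0 `<=`
    [set z : R * R | phase_domain d z /\ z.2 ^+ 2 + V0 z.1 = E0] /\
  flow_invariant d p0 mu0.
Proof.
move=> _ _ _ _ t01 _ _ _ _ h_gt0 h_cvg pot _ W0s W_cvg E_cvg Gs mdom mu_cvg V0 p0.
have Vs n : smooth_on `]0, +oo[ (V n) by have [[]] := pot n.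
have Ws n : smooth_on `[0, +oo[ (W n) by have [_ []] := pot n.
have VE n x : 0 < x -> V n x = x `^ gamma * W n x by have [_ [_ _ H] _ _ _] := pot n; exact: H.
have DV0 k : Dk k `]0, d[ V0 by exact: Dk_potential.
have dV0 (x : R) : 0 < x < d -> derivable V0 x 1.
  by move=> xd; apply: (Dk_derivable (DV0 0%N)); rewrite /= in_itv.
split.
- move=> z [zd zU]; split => //; apply/eqP; apply: contraT => qz.
  have cV0 x : 0 < x < d -> {for x, continuous V0}.
    by move=> /dV0/derivable_is_derive1; exact: is_derive1_continuous.
  have [r [sg [r0 sg1 al0 bed sgq]]] := off_surface_box cV0 zd qz.
  (* a bump function on a box where p0 - E0 keeps the sign sg *)
  pose a (w : R * R) := smooth_bump z.1 r w.1 * smooth_bump z.2 r w.2.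
  have sa : boxsym (z.1 - r) (z.1 + r) (`|z.2| + r) a by exact: boxsym_smooth_bump.
  have [sb lb] := energy_limit t01 h_gt0 h_cvg Vs Ws VE W0s W_cvg E_cvg Gs al0 bed sa.
  have ib := Rintegral_limit_eq0 mu_cvg al0 bed sb lb.
  pose U : set (R * R) := [set w | `|w.1 - z.1| < r] `&` [set w | `|w.2 - z.2| < r].
  have oU : open U.
    have cn (f : R * R -> R) (y : R) : continuous f -> continuous (fun w => `|f w - y|).
      by move=> cf w; apply: cvg_norm; apply: cvgB; [exact: cf|exact: cvg_cst].
    by apply: openI; apply: (open_comp _ (@open_lt R r)) => w _; apply: cn => u;
      [exact: cvg_fst|exact: cvg_snd].
  have mU : measurable (U : set (plane R)) by exact: open_plane_measurable.
  have Uz : U z by split; rewrite /= subrr normr0.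
  have := zU U oU Uz; rewrite (null_of_Rintegral0 mdom al0 bed sb _ _ mU sg1 ib) ?ltxx//.
  + move=> w /=; rewrite (_ : _ * _ = sg * (w.2 ^+ 2 + (V0 w.1 - E0)) * a w); last first.
      by rewrite /V0 /=; ring.
    have [w1|w1] := leP `|w.1 - z.1| r; last first.
      by rewrite /a smooth_bump_off ?mul0r ?mulr0// -ler_distl -ltNge.
    have [w2|w2] := leP `|w.2 - z.2| r; last first.
      by rewrite /a [X in _ * (_ * X)]smooth_bump_off ?mulr0// -ler_distl -ltNge.
    by rewrite mulr_ge0 ?(ltW (sgq _ w1 w2))// mulr_ge0// smooth_bump_ge0.
  + move=> w [/= w1 w2]; have := sgq w (ltW w1) (ltW w2) => sq.
    rewrite (_ : _ + _ = (w.2 ^+ 2 + (V0 w.1 - E0)) * a w); last by rewrite /V0 /=; ring.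
    rewrite mulf_neq0//; first by apply: contraTneq sq => ->; rewrite mulr0 ltxx.
    by rewrite /a mulf_neq0// gt_eqF// smooth_bump_gt0.
- move=> a sa; have [al [be [M [al0 bed sR sI]]]] := boxsym_symbol sa.
  have [bR lR] := flow_limit t01 h_gt0 h_cvg Vs Ws VE W0s W_cvg E_cvg Gs al0 bed sR.
  have [bI lI] := flow_limit t01 h_gt0 h_cvg Vs Ws VE W0s W_cvg E_cvg Gs al0 bed sI.
  have iR := Rintegral_limit_eq0 mu_cvg al0 bed bR lR.
  have iI := Rintegral_limit_eq0 mu_cvg al0 bed bI lI.
  rewrite /cintegral.
  have pE z : z \in phase_domain d -> poisson p0 a z = _ :=
    fun zd => poisson_kinetic a (dV0 z.1 (set_mem zd)).
  have -> : \int[mu0]_(x in phase_domain d) Re_fun (poisson p0 a) x = 0.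
    by rewrite -[RHS]iR; apply: eq_Rintegral => z /pE; rewrite /Re_fun => ->.
  have -> : \int[mu0]_(x in phase_domain d) Im_fun (poisson p0 a) x = 0.
    by rewrite -[RHS]iI; apply: eq_Rintegral => z /pE; rewrite /Im_fun => ->.
  by [].
Qed.
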